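(* Let $\mathcal{A}$ be a central hyperplane arrangement defined over a number field $K$, let $\boldsymbol{\mu}=(\mu_x)_{x\in\mathcal{L}(\mathcal{A})}$ be a tuple of nonnegative integers, and set $m=\sum_{x\in\mathcal{L}(\mathcal{A})}\mu_x$. Let $\mathfrak{o}$ be a compact discrete valuation ring which is an $\mathcal{O}_K$-algebra, with residue field of size $q$. Then $$\zeta^{\mathrm{ask}}_{\boldsymbol{\mu}_{\mathcal{A}}/\mathfrak{o}}(s)=(1-q^{-1})^{-1}\,\zeta_{c\mathcal{A}(\mathfrak{o})}\Big(\big(f_{\dim(\mathcal{A}),\underline{x}}(s,m,\boldsymbol{\mu})\big)_{\underline{x}\in\mathcal{L}(c\mathcal{A})\setminus\{\hat 0\}}\Big),$$ where for $\underline{x}\in\mathcal{L}(c\mathcal{A})\setminus\{\hat 0\}$ $$f_{\dim(\mathcal{A}),\underline{x}}(s,m,\boldsymbol{\mu})=\begin{cases}s+m-\mu_{\hat 0}-\dim(\mathcal{A})-1 & \text{if }\underline{x}=H_0,\\ -\mu_x & \text{if }\underline{x}>H_0,\\ 0&\text{otherwise,}\end{cases}$$ and for $\underline{x}\ge H_0$ the symbol $x$ denotes the element of $\mathcal{L}(\mathcal{A})$ corresponding to $\underline{x}$.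
   Context: Arrangements. A hyperplane arrangement $\mathcal{A}$ over a field $K$ is a finite set of affine hyperplanes in $K^{d}$, $d=\dim(\mathcal{A})$. Its intersection poset $\mathcal{L}(\mathcal{A})$ consists of all non-empty intersections of hyperplanes of $\mathcal{A}$ together with $\hat 0=K^d$ (the empty intersection), ordered by reverse inclusion; $\mathcal{A}$ is central if $\bigcap_{H\in\mathcal{A}}H\neq\varnothing$. For $x\in\mathcal{L}(\mathcal{A})$ let $\mathcal{A}_x=\{H\in\mathcal{A}: H\supseteq x\}$. For a number field $K$ with ring of integers $\mathcal{O}_K$, each $H\in\mathcal{A}$ is given as the zero locus of a fixed polynomial $L_H\in\mathcal{O}_K[X_1,\dots,X_d]$ of degree one; for central $\mathcal{A}$ the $L_H$ are taken to be homogeneous linear forms. Polynomials over $\mathcal{O}_K$ are viewed over an $\mathcal{O}_K$-algebra $\mathfrak{o}$ via the structure map. Matrix of linear forms. Let $E=\{(x,i): x\in\mathcal{L}(\mathcal{A}),\ 1\le i\le\mu_x\}$ and let $Z_{(H,e)}$, for $e=(x,i)\in E$ and $H\in\mathcal{A}_x$, be algebraically independent variables. The matrix $A^{\boldsymbol{\mu}}_{\mathcal{A}}(\boldsymbol{Z})$ is the $d\times|E|$ matrix of linear forms whose entry at $(j,e)$, with $1\le j\le d$ and $e=(x,i)$, is $\sum_{H\in\mathcal{A}_x}L_H(e_j)Z_{(H,e)}$, where $e_1,\dots,e_d$ is the standard basis. Ask zeta function. For a $d\times e$ matrix $A$ of linear forms in $n$ variables over a ring $R$ and a finite $R$-algebra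 $S$, $\mathrm{ask}_S(A)=|S|^{-n}\sum_{z\in S^n}|\ker A(z)|$, where $A(z)$ acts on rows: $\ker A(z)=\{v\in S^d: v^{\top}A(z)=0\}$. For a compact discrete valuation ring $\mathfrak{o}$ with maximal ideal $\mathfrak{p}$ and residue field of size $q$, $\zeta^{\mathrm{ask}}_{A/\mathfrak{o}}(s)=\sum_{k\ge0}\mathrm{ask}_{\mathfrak{o}/\mathfrak{p}^k}(A)q^{-ks}$. Write $\zeta^{\mathrm{ask}}_{\boldsymbol{\mu}_{\mathcal{A}}/\mathfrak{o}}(s)=\zeta^{\mathrm{ask}}_{A^{\boldsymbol{\mu}}_{\mathcal{A}}/\mathfrak{o}}(s)$. Cone. The cone $c\mathcal{A}$ is the arrangement in $K^{d+1}$ (coordinates $X_0,\dots,X_d$) defined by the homogenisations of the $L_H$, $H\in\mathcal{A}$ (which equal $L_H$ in the central case), together with $X_0$; $H_0=\ker(X_0)$. For central $\mathcal{A}$, the map sending $x\in\mathcal{L}(\mathcal{A})$ to $\underline{x}=cx\cap H_0$, where $cx\subseteq K^{d+1}$ is cut out by the (homogenised) equations of $x$, is an isomorphism of posets from $\mathcal{L}(\mathcal{A})$ onto $\{\underline{x}\in\mathcal{L}(c\mathcal{A}):\underline{x}\ge H_0\}$. Analytic zeta function of an arrangement. For an arrangement $\mathcal{B}$ over $K$ and complex variables $\boldsymbol{s}=(s_x)_{x\in\mathcal{L}(\mathcal{B})\setminus\{\hat 0\}}$, $\zeta_{\mathcal{B}(\mathfrak{o})}(\boldsymbol{s})=\int_{\mathfrak{o}^{\dim(\mathcal{B})}}\prod_{x\in\mathcal{L}(\mathcal{B})\setminus\{\hat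 0\}}\|\mathcal{B}_x\|^{s_x}\,d\mu$, where $\mu$ is the normalised Haar measure, $\|\mathcal{B}_x\|$ is the maximum of the absolute values $|L_H(\cdot)|$ over $H\in\mathcal{B}_x$, $|\cdot|$ being the absolute value on $\mathfrak{o}$ with $|\pi|=q^{-1}$ for a uniformiser $\pi$; factors with exponent $0$ are equal to $1$. The identity is one of functions of $s$, for $\mathrm{Re}(s)$ sufficiently large. *)

(* Defs.v *)
From HB Require Import structures.
From mathcomp Require Import all_boot all_order all_algebra.
From mathcomp Require Import generic_quotient ring_quotient fieldext.
From mathcomp Require Import finmap complex.
From mathcomp Require Import all_classical all_reals all_analysis.

Set Implicit Arguments.
Unset Strict Implicit.
Unset Printing Implicit Defensive.

Import Order.TTheory GRing.Theory Num.Theory.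
Import numFieldNormedType.Exports.

Local Open Scope classical_set_scope.
Local Open Scope ring_scope.

Definition ncard (T : choiceType) (X : set T) : nat := #|` fset_set X|.

Section RingOfIntegers.
Variable K : fieldExtType rat.

Definition integral_pred : {pred K} :=
  fun x => `[< integralOver (intr : int -> K) x >].

Lemma integral_pred_subring : subring_closed integral_pred.
Proof.
split=> [|x y|x y]; rewrite ?unfold_in.
- by apply/asboolP; exact: integral1.
- by move=> /asboolP hx /asboolP hy; apply/asboolP; exact: integral_sub.
- by move=> /asboolP hx /asboolP hy; apply/asboolP; exact: integral_mul.
Qed.

HB.instance Definition _ :=
  GRing.isSubringClosed.Build K integral_pred integral_pred_subring.

Record OK : Type := MkOK { OKval : K; OKvalP : OKval \in integral_pred }.

HB.instance Definition _ := [isSub for OKval].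
HB.instance Definition _ := [Choice of OK by <:].
HB.instance Definition _ := [SubChoice_isSubComNzRing of OK by <:].
HB.instance Definition _ := GRing.RMorphism.copy OKval (\val : OK -> K).

End RingOfIntegers.

Arguments OKval {K} _.

Section AffineForms.

(* The polynomial [aff_const + \sum_j aff_lin 0 j * X_j]. *)
Record affine_form (R : Type) (d : nat) := AffineForm {
  aff_const : R;
  aff_lin : 'rV[R]_d }.

Definition aff_eval (R S : pzRingType) (phi : R -> S) (d : nat)
    (L : affine_form R d) (v : 'rV[S]_d) : S :=
  phi (aff_const L) + \sum_(j < d) phi (aff_lin L 0 j) * v 0 j.

Definition homogenise (R : pzRingType) (d : nat) (L : affine_form R d) :
    affine_form R d.+1 :=
  AffineForm 0 (row_mx (aff_const L)%:M (aff_lin L) : 'rV[R]_(1 + d)).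

Definition coordX0 (R : pzRingType) (d : nat) : affine_form R d.+1 :=
  AffineForm 0 (delta_mx 0 ord0).

Definition zero_locus (K : fieldExtType rat) (d : nat)
    (L : affine_form (OK K) d) : set 'rV[K]_d :=
  [set v | aff_eval OKval L v = 0].

End AffineForms.

Record arrangement (K : fieldExtType rat) (d : nat) := Arrangement {
  hyp : finType;
  form : hyp -> affine_form (OK K) d;
  form_deg1 : forall H, aff_lin (form H) != 0;
  form_inj : injective (fun H => zero_locus (form H)) }.

Section IntersectionPoset.
Variables (K : fieldExtType rat) (d : nat) (A : arrangement K d).

Definition hyperplane (H : hyp A) : set 'rV[K]_d := zero_locus (form H).

Definition intersection (S : {set hyp A}) : set 'rV[K]_d :=
  \bigcap_(H in [set` S]) hyperplane H.

Definition central : Prop := intersection [set: hyp A]%SET !=set0.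

Definition homogeneous : Prop := forall H : hyp A, aff_const (form H) = 0.

Definition is_flat (x : set 'rV[K]_d) : Prop :=
  x !=set0 /\ exists S : {set hyp A}, x = intersection S.

Record flat : Type := MkFlat {
  flat_pts : set 'rV[K]_d;
  flatP : `[< is_flat flat_pts >] }.

HB.instance Definition _ := [isSub for flat_pts].
HB.instance Definition _ := [Choice of flat by <:].

(* [A_x], as a set of indices. *)
Definition hyps_over (x : flat) : {set hyp A} :=
  finset (fun H => `[< flat_pts x `<=` hyperplane H >]).

Lemma intersection_hyps_over (x : flat) :
  intersection (hyps_over x) = flat_pts x.
Proof.
case: x => x xP; have [_ [S xS]] := asboolW xP.
apply/seteqP; split=> v /=.
  move=> xv; rewrite xS => H /= HS; apply: xv => /=; rewrite inE /=.
  by apply/asboolP => w; rewrite xS; exact.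
by move=> xv H /=; rewrite inE => /asboolP; exact.
Qed.

Lemma hyps_over_inj : injective hyps_over.
Proof.
move=> x y xy; apply: val_inj => /=.
by rewrite -!intersection_hyps_over xy.
Qed.

Definition flat_of_hyps (S : {set hyp A}) : option flat :=
  insub (intersection S).

Lemma hyps_overK : pcancel hyps_over flat_of_hyps.
Proof.
by move=> x; rewrite /flat_of_hyps intersection_hyps_over; exact: valK.
Qed.

HB.instance Definition _ := PCanIsCountable hyps_overK.
HB.instance Definition _ := fintype.isFinite.Build flat (pcan_enumP hyps_overK).

Definition flat_le (x y : flat) : bool := `[< flat_pts y `<=` flat_pts x >].

Lemma flat_le_refl : reflexive flat_le.
Proof. by move=> x; apply/asboolP. Qed.

Lemma flat_le_anti : antisymmetric flat_le.
Proof.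
move=> x y /andP[/asboolP yx /asboolP xy]; apply: val_inj => /=.
exact/seteqP.
Qed.

Lemma flat_le_trans : transitive flat_le.
Proof.
move=> y x z /asboolP yx /asboolP zy; apply/asboolP.
exact: subset_trans zy yx.
Qed.

Definition flat_display : Order.disp_t.
Proof. exact: Order.Disp tt tt. Qed.

HB.instance Definition _ := Order.Le_isPOrder.Build flat_display flat
  flat_le_refl flat_le_anti flat_le_trans.

Lemma is_flatT : is_flat [set: 'rV[K]_d].
Proof.
split; first by exists 0.
exists finset.set0; apply/seteqP; split=> v //= _ H /=.
by rewrite inE.
Qed.

Definition flat_hat0 : flat := MkFlat (asboolT is_flatT).

Lemma flat_hat0_le (x : flat) : (flat_hat0 <= x)%O.
Proof. exact/asboolP. Qed.

HB.instance Definition _ :=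
  Order.hasBottom.Build flat_display flat flat_hat0_le.

Lemma is_flat_homogeneous (hA : homogeneous) (S : {set hyp A}) :
  is_flat (intersection S).
Proof.
split; last by exists S.
exists 0 => H /= _; rewrite /hyperplane /zero_locus /= /aff_eval hA rmorph0.
by rewrite big1 ?addr0// => j _; rewrite mxE mulr0.
Qed.

Definition homogeneous_flat (hA : homogeneous) (S : {set hyp A}) : flat :=
  MkFlat (asboolT (is_flat_homogeneous hA S)).

End IntersectionPoset.

Section Cone.
Variables (K : fieldExtType rat) (d : nat) (A : arrangement K d).

(* [None] stands for the additional hyperplane [H_0], given by [X_0]. *)
Definition cone_form (H : option (hyp A)) : affine_form (OK K) d.+1 :=
  if H is Some H' then homogenise (form H') else coordX0 (OK K) d.

Let row_mx0 (T : Type) (a : 'M[T]_1) (v : 'rV[T]_d) :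
  (row_mx a v : 'rV[T]_d.+1) 0 ord0 = a 0 0.
Proof.
by rewrite mxE; case: splitP => // k _; rewrite ord1.
Qed.

Let row_mxS (T : Type) (a : 'M[T]_1) (v : 'rV[T]_d) j :
  (row_mx a v : 'rV[T]_d.+1) 0 (lift ord0 j) = v 0 j.
Proof.
rewrite mxE; case: splitP => k /=; rewrite /bump /= add1n.
  by rewrite ord1.
by move=> [jk]; congr (v 0 _); exact/val_inj.
Qed.

Lemma homogenise_eval (L : affine_form (OK K) d) (a : K) (v : 'rV[K]_d) :
  aff_eval OKval (homogenise L) (row_mx a%:M v : 'rV_(1 + d)) =
  OKval (aff_const L) * a + \sum_(j < d) OKval (aff_lin L 0 j) * v 0 j.
Proof.
rewrite /aff_eval rmorph0 add0r big_ord_recl !row_mx0 !mxE !eqxx !mulr1n.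
by congr (_ + _); apply: eq_bigr => j _; rewrite !row_mxS.
Qed.

Lemma coordX0_eval (a : K) (v : 'rV[K]_d) :
  aff_eval OKval (coordX0 (OK K) d) (row_mx a%:M v : 'rV_(1 + d)) = a.
Proof.
rewrite /aff_eval rmorph0 add0r big_ord_recl row_mx0 !mxE !eqxx mulr1n.
rewrite big1 ?addr0 => [|j _]; first by rewrite rmorph1 mul1r.
by rewrite !mxE /= mul0r.
Qed.

Lemma cone_form_deg1 H : aff_lin (cone_form H) != 0.
Proof.
case: H => [H|] /=; last first.
  apply/eqP => /rowP/(_ ord0); rewrite !mxE !eqxx.
  by apply/eqP; exact: oner_neq0.
apply: contra (form_deg1 H) => /eqP/(congr1 (@rsubmx _ 1 1 d)).
rewrite row_mxKr => ->; apply/eqP; exact: linear0.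
Qed.

Lemma cone_form_neq (H : hyp A) :
  zero_locus (homogenise (form H)) <> zero_locus (coordX0 (OK K) d).
Proof.
move=> HX0; have /eqP := form_deg1 H; apply; apply/rowP => j.
have : zero_locus (coordX0 (OK K) d)
    (row_mx (0 : K)%:M (delta_mx 0 j) : 'rV[K]_(1 + d)).
  exact: coordX0_eval.
rewrite -HX0 /zero_locus /= homogenise_eval mulr0 add0r (bigD1 j)//= big1.
  rewrite !mxE !eqxx mulr1 addr0 => Hj; exact: val_inj.
by move=> i ij; rewrite mxE eqxx (negPf ij) mulr0.
Qed.

Lemma cone_form_inj : injective (fun H => zero_locus (cone_form H)).
Proof.
move=> [H|] [H'|] //= HH'; [congr Some|by have := cone_form_neq HH'|
  by have := cone_form_neq (esym HH')].
apply: form_inj; apply/seteqP.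
have homE (G : hyp A) (v : 'rV[K]_d) : zero_locus (form G) v <->
    zero_locus (homogenise (form G)) (row_mx (1 : K)%:M v : 'rV[K]_(1 + d)).
  by rewrite /zero_locus /= homogenise_eval mulr1.
by split=> v /homE; [rewrite HH'|rewrite -HH']; move/homE.
Qed.

Definition cone : arrangement K d.+1 :=
  Arrangement cone_form_deg1 cone_form_inj.

Lemma cone_homogeneous : homogeneous cone.
Proof. by case. Qed.

Definition cone_H0 : flat cone :=
  homogeneous_flat cone_homogeneous [set None : hyp cone]%SET.

(* [cx], cut out by the homogenised equations of [x], intersected with [H_0]. *)
Definition underline (x : flat A) : flat cone :=
  homogeneous_flat cone_homogeneous
    (None |: (@Some (hyp A) @: hyps_over x))%SET.

End Cone.

Section LinearForms.

(* A linear form in [n] variables is the row vector of its coefficients, so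
   that [delta_mx 0 i] is the [i]-th variable. *)
Definition lf_eval (R S : pzRingType) (phi : R -> S) (n : nat) (l : 'rV[R]_n)
    (z : 'rV[S]_n) : S := \sum_(i < n) phi (l 0 i) * z 0 i.

Definition lfmx_eval (R S : pzRingType) (phi : R -> S) (d e n : nat)
    (A : 'M['rV[R]_n]_(d, e)) (z : 'rV[S]_n) : 'M[S]_(d, e) :=
  map_mx (fun l => lf_eval phi l z) A.

Definition ask (F : realType) (R S : pzRingType) (phi : R -> S) (d e n : nat)
    (A : 'M['rV[R]_n]_(d, e)) : F :=
  (ncard [set: S])%:R ^- n *
  \sum_(z \in [set: 'rV[S]_n])
    ((ncard [set v : 'rV[S]_d | v *m lfmx_eval phi A z = 0])%:R : F).

End LinearForms.

Section ArrangementMatrix.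
Variables (K : fieldExtType rat) (d : nat) (A : arrangement K d).
Variable mu : flat A -> nat.

Definition mu_index : Type := {x : flat A & 'I_(mu x)}.

HB.instance Definition _ :=
  Finite.on mu_index.

Definition var_index : Type :=
  {e : mu_index & {H : hyp A | H \in hyps_over (tag e)}}.

HB.instance Definition _ := Finite.copy var_index
  {e : mu_index & {H : hyp A | H \in hyps_over (tag e)}}.

Definition Zvar (v : var_index) : 'rV[OK K]_#|{: var_index}| :=
  delta_mx 0 (enum_rank v).

Definition mu_matrix :
    'M['rV[OK K]_#|{: var_index}|]_(d, #|{: mu_index}|) :=
  \matrix_(j < d, c < #|{: mu_index}|)
    let e := enum_val c in
    \sum_(H : {H : hyp A | H \in hyps_over (tag e)})
      aff_eval id (form (val H)) (delta_mx 0 j)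
        *: Zvar (existT (fun e => {H : hyp A | H \in hyps_over (tag e)}) e H).

End ArrangementMatrix.

Section PowersOfMaximalIdeal.
Variable o : idomainType.

Definition maxideal : set o := [set x | x \isn't a GRing.unit].

Definition maxideal_pow (k : nat) : {pred o} := fun x =>
  `[< exists s : seq (o * k.-tuple o),
        (forall t y, t \in s -> y \in (t.2 : seq o) -> maxideal y) /\
        x = \sum_(t <- s) t.1 * \prod_(y <- t.2) y >].

Lemma maxideal_powMl k a x : x \in maxideal_pow k -> a * x \in maxideal_pow k.
Proof.
rewrite !unfold_in => /asboolP[s [sm ->]]; apply/asboolP.
exists [seq (a * t.1, t.2) | t <- s]; split=> [_ y /mapP[t ts ->] /=|].
  exact: sm ts.
by rewrite big_map mulr_sumr; apply: eq_bigr => t _; rewrite mulrA.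
Qed.

Lemma maxideal_powD k x y : x \in maxideal_pow k -> y \in maxideal_pow k ->
  x + y \in maxideal_pow k.
Proof.
rewrite !unfold_in => /asboolP[s [sm ->]] /asboolP[t [tm ->]]; apply/asboolP.
exists (s ++ t); split=> [u z|]; last by rewrite big_cat.
by rewrite mem_cat => /orP[/sm|/tm]; exact.
Qed.

Lemma maxideal_pow_zmod k : zmod_closed (maxideal_pow k).
Proof.
split=> [|x y xk yk].
  by rewrite unfold_in; apply/asboolP; exists [::]; rewrite big_nil.
by apply: maxideal_powD => //; rewrite -mulN1r; exact: maxideal_powMl.
Qed.

HB.instance Definition _ k :=
  GRing.isZmodClosed.Build o (maxideal_pow k) (maxideal_pow_zmod k).

(* The ring structure that the library puts on quotients requires a proper
   ideal; here [k = 0] is allowed and yields the zero ring. *)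
Definition residue_ring (k : nat) : Type := Quotient.quot (maxideal_pow k).

HB.instance Definition _ k := GRing.Zmodule.on (residue_ring k).

Definition residue (k : nat) (x : o) : residue_ring k :=
  (\pi_(Quotient.quot (maxideal_pow k)) x)%qT.

Definition residue_repr (k : nat) (a : residue_ring k) : o :=
  repr (a : Quotient.quot (maxideal_pow k)).

Lemma residue_reprK k : cancel (@residue_repr k) (@residue k).
Proof. by move=> a; rewrite /residue /residue_repr reprK. Qed.

Lemma residue_eq k x y : residue k x = residue k y <-> x - y \in maxideal_pow k.
Proof.
rewrite /residue (_ : (x - y \in _) = (Quotient.equiv (maxideal_pow k) x y))//.
by split=> [/eqP|xy]; [|apply/eqP]; rewrite piE.
Qed.

Definition residue_one k : residue_ring k := residue k 1.

Definition residue_mul k (a b : residue_ring k) : residue_ring k :=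
  residue k (residue_repr a * residue_repr b).

Lemma residue_is_additive k : zmod_morphism (residue k).
Proof. exact: pi_is_zmod_morphism. Qed.

Lemma residue_mulE k x y :
  residue_mul (residue k x) (residue k y) = residue k (x * y).
Proof.
have reprB z : residue_repr (residue k z) - z \in maxideal_pow k.
  by apply/residue_eq; rewrite residue_reprK.
apply/residue_eq; set x' := residue_repr _; set y' := residue_repr _.
have -> : x' * y' - x * y = y' * (x' - x) + x * (y' - y).
  by rewrite !mulrBr [y' * x']mulrC [y' * x]mulrC addrA subrK.
by apply: maxideal_powD; exact: maxideal_powMl (reprB _).
Qed.

Lemma residue_mulA k : associative (@residue_mul k).
Proof.
move=> a b c; rewrite -(residue_reprK a) -(residue_reprK b) -(residue_reprK c).
by rewrite !residue_mulE mulrA.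
Qed.

Lemma residue_mulC k : commutative (@residue_mul k).
Proof.
move=> a b; rewrite -(residue_reprK a) -(residue_reprK b).
by rewrite !residue_mulE mulrC.
Qed.

Lemma residue_mul1 k : left_id (residue_one k) (@residue_mul k).
Proof.
by move=> a; rewrite -(residue_reprK a) residue_mulE mul1r.
Qed.

Lemma residue_mulDl k : left_distributive (@residue_mul k) +%R.
Proof.
have DE x y : residue k x + residue k y = residue k (x + y).
  have := residue_is_additive k (x + y) y; rewrite addrK => ->.
  by rewrite subrK.
move=> a b c; rewrite -(residue_reprK a) -(residue_reprK b) -(residue_reprK c).
by rewrite DE !residue_mulE DE mulrDl.
Qed.

HB.instance Definition _ k := GRing.Zmodule_isComPzRing.Build (residue_ring k)
  (@residue_mulA k) (@residue_mulC k) (@residue_mul1 k) (@residue_mulDl k).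

HB.instance Definition _ k :=
  GRing.isZmodMorphism.Build o (residue_ring k) (residue k)
    (residue_is_additive k).

Lemma residue_is_multiplicative k : monoid_morphism (residue k).
Proof. by split=> // x y; rewrite -residue_mulE. Qed.

HB.instance Definition _ k :=
  GRing.isMonoidMorphism.Build o (residue_ring k) (residue k)
    (residue_is_multiplicative k).

Definition residue_card : nat := ncard [set: residue_ring 1].

End PowersOfMaximalIdeal.

#[short(type="topIdomainType")]
HB.structure Definition TopIdomain :=
  {o of Topological o & GRing.IntegralDomain o}.

Section CompactDVR.

Definition is_ideal (o : idomainType) (I : set o) : Prop :=
  [/\ I 0, forall x y, I x -> I y -> I (x + y) & forall a x, I x -> I (a * x)].

(* A local principal ideal domain that is not a field. *)
Record is_dvr (o : idomainType) : Prop := IsDVR {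
  dvr_local : is_ideal (@maxideal o);
  dvr_principal : forall I : set o, is_ideal I ->
    exists a, I = [set r * a | r in [set: o]];
  dvr_not_field : exists2 x : o, x != 0 & maxideal x }.

Record is_compact_dvr (o : topIdomainType) : Prop := IsCompactDVR {
  cdvr_dvr : is_dvr o;
  cdvr_nbhs : forall x : o, nbhs x =
    filter_from [set: nat] (fun k => [set y | y - x \in maxideal_pow k]);
  cdvr_compact : compact [set: o] }.

End CompactDVR.

Section AbsoluteValue.
Variables (F : realType) (o : idomainType).

Definition valuation (x : o) : nat :=
  xget 0%N [set k | x \in maxideal_pow k /\ x \notin maxideal_pow k.+1].

Definition absv (x : o) : F :=
  if x == 0 then 0 else (residue_card o)%:R ^- valuation x.

End AbsoluteValue.

Local Open Scope complex_scope.

(* Meant for [a >= 0]; [0] to the power [0] is [1] and [0] to any other power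
   is [0]. *)
Definition cpow (F : realType) (a : F) (s : F[i]) : F[i] :=
  if s == 0 then 1 else if a == 0 then 0 else
  (expR (complex.Re s * ln a))%:C *
  (cos (complex.Im s * ln a) +i* sin (complex.Im s * ln a)).

Section AskZeta.
Variables (F : realType) (o : idomainType) (d e n : nat).
Variable A : 'M['rV[o]_n]_(d, e).

Definition ask_zeta_term (s : F[i]) (k : nat) : F[i] :=
  (ask F (residue k : o -> residue_ring o k) A)%:C *
  cpow (residue_card o)%:R (- (k%:R * s)).

Definition ask_zeta_series (s : F[i]) : nat -> F[i]^o :=
  series (ask_zeta_term s).

Definition ask_zeta (s : F[i]) : F[i] := limn (ask_zeta_series s).

End AskZeta.

Definition row_space (o : topIdomainType) (n : nat) : Type := 'rV[o]_n.

HB.instance Definition _ o n := Topological.copy (row_space o n) 'rV[o]_n.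
HB.instance Definition _ o n := isPointed.Build (row_space o n) (0 : 'rV[o]_n).

Definition borel (o : topIdomainType) (n : nat) :=
  g_sigma_algebraType (@open (row_space o n)).

Section ArrangementZeta.
Variables (F : realType) (o : topIdomainType).

(* [borel o n] is [o^n] with its Borel sets and [P] has total mass one, so
   translation invariance makes [P] the normalised Haar measure. *)
Definition is_haar (n : nat) (P : probability (borel o n) F) : Prop :=
  forall (a : 'rV[o]_n) (E : set (borel o n)), measurable E ->
    P [set a + v | v in E] = P E.

Variables (K : fieldExtType rat) (n : nat) (B : arrangement K n).
Variable phi : OK K -> o.
Variable P : probability (borel o n) F.

Definition arr_norm (x : flat B) (v : 'rV[o]_n) : F :=
  \big[Num.max/0]_(H in hyps_over x) absv F (aff_eval phi (form H) v).

Definition zeta_integrand (s : flat B -> F[i]) (v : 'rV[o]_n) : F[i] :=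
  \prod_(x : flat B | x != \bot%O) cpow (arr_norm x v) (s x).

Definition zeta_integrable (s : flat B -> F[i]) : Prop :=
  P.-integrable setT (fun v => (complex.Re (zeta_integrand s v))%:E) /\
  P.-integrable setT (fun v => (complex.Im (zeta_integrand s v))%:E).

Definition arr_zeta (s : flat B -> F[i]) : F[i] :=
  (\int[P]_v complex.Re (zeta_integrand s v))%R +i*
  (\int[P]_v complex.Im (zeta_integrand s v))%R.

End ArrangementZeta.

Definition cone_exponent (F : realType) (K : fieldExtType rat) (d : nat)
    (A : arrangement K d) (s : F[i]) (m : nat) (mu : flat A -> nat)
    (y : flat (cone A)) : F[i] :=
  if y == cone_H0 A then s + m%:R - (mu \bot%O)%:R - d%:R - 1
  else if (cone_H0 A < y)%O then
    (* for [A] homogeneous there is exactly one such [x] *)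
    if [pick x : flat A | underline x == y] is Some x then - (mu x)%:R else 0
  else 0.

(* Main.v *)
Require Import Defs.
From HB Require Import structures.
From mathcomp Require Import all_boot all_order all_algebra fieldext complex.
From mathcomp Require Import finmap ring lra.
From mathcomp Require Import all_classical all_reals all_analysis.

(** Write R_k = o/p^k.  Summing first over the variables z, a row vector v of R_k
contributes to ask_k the proportion of the z with v A(z) = 0.  Column (x, i) of
v A(z) ranges over the ideal I_x(v) of R_k generated by the L_H(v), H in A_x, and
the columns involve disjoint sets of variables; hence the proportion is
prod_x |I_x(v)|^(-mu_x).

On the other side, cut o^(d+1) into the shells {|v_0| = q^(-k), (v_1, ..., v_d) = a mod p^k}.
On such a shell ||A_x, X_0|| = |I_x(a)| / q^k, so that the integrand is constant,
and its integral over all the shells of level k is (1 - q^(-1)) ask_k q^(-ks). *)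

Set Implicit Arguments.
Unset Strict Implicit.
Unset Printing Implicit Defensive.

Import Order.TTheory GRing.Theory Num.Theory.
Import numFieldNormedType.Exports.

Local Open Scope classical_set_scope.
Local Open Scope ring_scope.

(** The coordinate X_0 encodes the level k: as |X_0| = q^(-k) on a shell of level k, the powers of
    q^k left over in the comparison are absorbed by the exponent at H_0. Write m' = m - mu_hat0.
    Normalising the ideal sizes gives q^(-k m'), the zeta variable gives q^(-k s), and a shell has
    measure proportional to q^(-k (d + 1)); matching these forces the exponent s + m' - d - 1. The
    flat hat0 is missing from m' because K^d lies in no hyperplane, so that I_hat0(v) is the zero
    ideal.

    Neither convergence is estimated by itself. For Re(s) > d + 1 the integrand is bounded by 1,
    hence integrable over a probability space, and the absolute convergence of the ask series is
    read off from countable additivity. On the locus v_0 = 0, which no shell meets, the integrand is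
    shown to vanish, so its measure need not be computed. *)

Section FiniteTypes.

Lemma ncardE (T : finType) (X : set T) : ncard X = #|[set x | x \in X]%SET|.
Proof.
rewrite /ncard cardfE -(card_imset _ val_inj); apply: eq_card => x.
rewrite inE; apply/imsetP/idP => [[y _ ->]|xX].
  by rewrite -in_fset_set ?fsvalP//; exact: finite_finset.
have xX' : x \in fset_set X by rewrite in_fset_set//; exact: finite_finset.
by exists [` xX']%fset.
Qed.

Lemma ncardT (T : finType) : ncard [set: T] = #|T|.
Proof. by rewrite ncardE -cardsT; congr #|pred_of_set _|; apply/setP => x; rewrite !inE in_setT. Qed.

Lemma fsbig_finType (R : Type) (idx : R) (op : Monoid.com_law idx) (T : finType)
    (f : T -> R) :
  \big[op/idx]_(i \in [set: T]) f i = \big[op/idx]_(i : T) f i.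
Proof.
rewrite fsbig_finite; last exact: finite_finset.
rewrite -big_enum; apply: perm_big; apply: uniq_perm; rewrite ?enum_uniq ?fset_uniq//.
move=> x; rewrite mem_enum in_fset_set; last exact: finite_finset.
by rewrite in_setT.
Qed.

Variables (S : comPzRingType) (S_fin : finite_set [set: S]).

Let enumS : seq S := fset_set [set: S].

Let mem_enumS x : x \in enumS.
Proof. by rewrite /enumS in_fset_set ?in_setT. Qed.

Let enumS_axiom : Finite.axiom enumS.
Proof. by move=> x; rewrite count_uniq_mem ?mem_enumS ?fset_uniq. Qed.

Let indexK : cancel (index^~ enumS) (nth 0 enumS).
Proof. by move=> x; rewrite nth_index ?mem_enumS. Qed.

(** The ring structure of [S] is kept, so elements of [S] and morphisms into it can be reused. The
    zero ring must be allowed because of o/p^0. *)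
Definition finite_ring : finComPzRingType :=
  HB.pack (GRing.ComPzRing.sort S) (GRing.ComPzRing.class S)
    (CanIsCountable indexK) (fintype.isFinite.Build S enumS_axiom).

End FiniteTypes.

(** * Discrete valuation rings and their residue rings *)

Section DiscreteValuationRing.
Variables (o : idomainType) (o_dvr : is_dvr o).

Lemma dvr_uniformizer :
  exists2 pi : o, pi != 0 & forall x, maxideal x <-> exists r, x = pi * r.
Proof.
have [pi piE] := dvr_principal o_dvr (dvr_local o_dvr).
have memE x : maxideal x <-> exists r, x = pi * r.
  by rewrite piE; split=> [[r _ <-]|[r ->]]; exists r => //; rewrite mulrC.
exists pi => //; apply/eqP => pi0.
have [x x0 /memE[r xE]] := dvr_not_field o_dvr.
by rewrite xE pi0 mul0r eqxx in x0.
Qed.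

Variables (pi : o) (pi0 : pi != 0).
Hypothesis piP : forall x : o, maxideal x <-> exists r, x = pi * r.

Lemma uniformizer_nonunit : pi \isn't a GRing.unit.
Proof. by apply/piP; exists 1; rewrite mulr1. Qed.

Lemma maxideal_powP k (x : o) : x \in maxideal_pow k <-> exists r, x = pi ^+ k * r.
Proof.
rewrite unfold_in; split=> [/asboolP[s [sm ->]]|[r ->]].
  elim: s sm => [|[a t] s IH] sm.
    by exists 0; rewrite big_nil mulr0.
  rewrite big_cons /=.
  have [|r ->] := IH; first by move=> u y us; apply: sm; rewrite inE us orbT.
  have {}sm y : y \in (t : seq o) -> exists r, y = pi * r.
    by move=> yt; apply/piP; apply: (sm (a, t)) => //; rewrite inE eqxx.
  suff [c ->] : exists c, \prod_(y <- t) y = pi ^+ k * c.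
    by exists (a * c + r); rewrite mulrDr mulrCA.
  case: t sm => t /= /eqP <-; elim: t {IH} => [|y u IH] sm.
    by exists 1; rewrite big_nil mulr1.
  have [|c cE] := IH; first by move=> z zu; apply: sm; rewrite inE zu orbT.
  have [|b ->] := sm y; first by rewrite inE eqxx.
  by exists (b * c); rewrite big_cons cE exprS mulrACA.
apply/asboolP; exists [:: (r, nseq_tuple k pi)]; split=> [t y|].
  rewrite inE => /eqP -> /nseqP[-> _]; exact: uniformizer_nonunit.
by rewrite big_seq1 /= big_nseq iter_mulr_1 mulrC.
Qed.

Lemma maxideal_pow_le k l (x : o) : (l <= k)%N ->
  x \in maxideal_pow k -> x \in maxideal_pow l.
Proof.
move=> lk /maxideal_powP[r ->]; apply/maxideal_powP.
by exists (pi ^+ (k - l) * r); rewrite mulrA -exprD subnKC.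
Qed.

Lemma maxideal_pow0 (x : o) : x \in maxideal_pow 0.
Proof. by apply/maxideal_powP; exists x; rewrite mul1r. Qed.

Lemma uniformizer_expM k l (r : o) :
  (pi ^+ k * r \in maxideal_pow (k + l)) = (r \in maxideal_pow l).
Proof.
apply/idP/idP => /maxideal_powP[c].
  rewrite exprD -mulrA => /(mulfI (expf_neq0 k pi0)) ->.
  by apply/maxideal_powP; exists c.
by move=> ->; apply/maxideal_powP; exists c; rewrite exprD mulrA.
Qed.

(** Krull's intersection theorem for a principal ideal domain: if x = pi^k y_k for all k, the ideals
    (y_k) increase, and their union [I] is generated by some element of a single (y_k). Then y_(k+1)
    is a multiple of y_k = pi y_(k+1), which would make pi a unit. *)
Lemma maxideal_pow_bigcap (x : o) : (forall k, x \in maxideal_pow k) -> x = 0.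
Proof.
move=> xk; have [//|x0] := eqVneq x 0.
have /choice[y yE] k : exists r, x = pi ^+ k * r by apply/maxideal_powP.
have yS k : y k = pi * y k.+1.
  apply: (mulfI (expf_neq0 k pi0)).
  by rewrite -yE mulrA -exprSr -yE.
pose I : set o := [set z | exists k r, z = r * y k].
have yle k l : (k <= l)%N -> exists r, y k = r * y l.
  move=> /subnKC <-; elim: (l - k)%N => [|n [r rE]].
    by exists 1; rewrite addn0 mul1r.
  by exists (r * pi); rewrite addnS -mulrA -yS.
have II : is_ideal I.
  split; first by exists 0, 0; rewrite mul0r.
    move=> _ _ [k [r ->]] [l [t ->]].
    have [a aE] := yle _ _ (leq_maxl k l); have [b bE] := yle _ _ (leq_maxr k l).
    by exists (maxn k l), (r * a + t * b); rewrite mulrDl -!mulrA -aE -bE.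
  by move=> a _ [k [r ->]]; exists k, (a * r); rewrite mulrA.
have [g gE] := dvr_principal o_dvr II.
have [k [r gk]] : I g by rewrite gE; exists 1 => //; rewrite mul1r.
have [c _ cE] : [set r * g | r in [set: o]] (y k.+1).
  by rewrite -gE; exists k.+1, 1; rewrite mul1r.
have y0 : y k.+1 != 0 by apply: contra x0 => /eqP y0; rewrite (yE k.+1) y0 mulr0.
have := uniformizer_nonunit; suff -> : pi \is a GRing.unit by [].
apply/unitrPr; exists (c * r); apply: (mulIf y0).
by rewrite mul1r -[RHS]cE gk (yS k) !mulrA -[pi * c * r]mulrA [pi * (c * r)]mulrC.
Qed.

Lemma dvr_decomp (x : o) : x != 0 ->
  exists k u, u \is a GRing.unit /\ x = pi ^+ k * u.
Proof.
move=> x0; have /contrapT : ~ ~ exists k, x \notin maxideal_pow k.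
  move=> /forallNP h; move/eqP: x0; apply; apply: maxideal_pow_bigcap => k.
  exact/negPn/negP/h.
case/cid => n; elim: n => [|n IH] xn; first by rewrite maxideal_pow0 in xn.
have [/maxideal_powP[r xE]|/IH//] := boolP (x \in maxideal_pow n).
exists n, r; split=> //; apply/negPn/negP => /piP[c rE].
by move/negP: xn; apply; apply/maxideal_powP; exists c; rewrite xE rE exprSr mulrA.
Qed.

Lemma uniformizer_exp_unit k l (u : o) : u \is a GRing.unit ->
  (pi ^+ k * u \in maxideal_pow l) = (l <= k)%N.
Proof.
move=> uu; apply/idP/idP => [h|lk]; last first.
  by apply: (maxideal_pow_le lk); apply/maxideal_powP; exists u.
rewrite leqNgt; apply/negP => kl.
have := maxideal_pow_le kl h; rewrite -addn1 uniformizer_expM.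
move=> /maxideal_powP[r]; rewrite expr1 => uE.
have /piP : exists r, u = pi * r by exists r.
by rewrite /maxideal /= uu.
Qed.

Lemma valuation_expM k (u : o) : u \is a GRing.unit -> valuation (pi ^+ k * u) = k.
Proof.
move=> uu; rewrite /valuation; apply: xget_subset1.
  by split; rewrite /= uniformizer_exp_unit// ltnn.
move=> i j /= [+ +] [+ +]; rewrite !uniformizer_exp_unit// -!ltnNge.
move=> a b c e; apply/eqP; rewrite eqn_leq.
by rewrite (leq_trans a) 1?(leq_trans c).
Qed.

Lemma absv_expM (F : realType) k (u : o) : u \is a GRing.unit ->
  absv F (pi ^+ k * u) = (residue_card o)%:R ^- k.
Proof.
move=> uu; have /negPf u0 : u != 0 by apply: contraTneq uu => ->; rewrite unitr0.
by rewrite /absv mulf_eq0 (negPf (expf_neq0 _ pi0)) u0 valuation_expM.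
Qed.

Lemma residue_eq0 k (x : o) : (residue k x == 0) = (x \in maxideal_pow k).
Proof.
rewrite -[x in RHS]subr0; apply/eqP/idP => [x0|/residue_eq ->]; last exact: raddf0.
by apply/residue_eq; rewrite x0 raddf0.
Qed.

Hypothesis residue_finite : forall k, finite_set [set: residue_ring o k].
Let R k : finComPzRingType := finite_ring (residue_finite k).
Let q := residue_card o.

(** The map [g] expands a residue modulo p^(k+l) into two digits a + pi^k b. It is only a bijection
    of sets: a is recovered modulo p^k, then b after cancelling pi^k. *)
Lemma card_residueD k l : #|R (k + l)%N| = (#|R k| * #|R l|)%N.
Proof.
rewrite -card_prod.
pose g (a : R k * R l) : R (k + l)%N :=
  residue (k + l) (residue_repr (k := k) a.1 + pi ^+ k * residue_repr (k := l) a.2).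
have g_inj : injective g.
  move=> [a b] [a' b'] /residue_eq /=.
  rewrite opprD addrACA -mulrBr => h.
  have aa' : a = a'.
    rewrite -(residue_reprK a) -(residue_reprK a'); apply/residue_eq.
    move: (maxideal_pow_le (leq_addr l k) h); rewrite rpredDr//.
    by apply/maxideal_powP; eexists.
  move: h; rewrite aa' subrr add0r uniformizer_expM => /residue_eq.
  by rewrite !residue_reprK => ->.
rewrite -(card_codom g_inj); apply/esym/eq_card => y; rewrite inE.
apply/codomP; pose r := residue_repr (k := (k + l)%N) y.
have : r - residue_repr (residue k r) \in maxideal_pow k.
  by apply/residue_eq; rewrite residue_reprK.
move=> /maxideal_powP[c cE]; exists (residue k r, residue l c).
rewrite -[LHS](residue_reprK (k := (k + l)%N)); apply/residue_eq.
rewrite /= opprD addrA cE -mulrBr uniformizer_expM; apply/residue_eq.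
by rewrite residue_reprK.
Qed.

Lemma card_residue k : #|R k| = (q ^ k)%N.
Proof.
elim: k => [|k IH]; last first.
  by rewrite -addn1 card_residueD IH expnD /q /residue_card -(ncardT (R 1)).
rewrite expn0 -(card_ord 1); apply: (@bij_eq_card _ _ (fun=> ord0)).
exists (fun=> 0) => [x|x]; last by rewrite [RHS]ord1.
by apply/esym/eqP; rewrite -[x](residue_reprK (k := 0)) residue_eq0 maxideal_pow0.
Qed.

Lemma residue_card_gt1 : (1 < q)%N.
Proof.
rewrite -[q]expn1 -card_residue; apply/card_gt1P; exists 0, 1; split=> //.
rewrite eq_sym -(rmorph1 (residue 1)) residue_eq0.
have := uniformizer_exp_unit 0 1 (unitr1 o).
by rewrite expr0 mulr1 => ->.
Qed.

(** Multiplication by pi^j induces a bijection from o/p^(k-j) onto the ideal generated by pi^j in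
    o/p^k. *)
Lemma card_residue_principal k j : (j <= k)%N ->
  #|[set y : R k | `[< exists t : R k, y = residue k (pi ^+ j) * t >]]%SET| = (q ^ (k - j))%N.
Proof.
move=> jk; rewrite -card_residue.
pose g (b : R (k - j)%N) : R k := residue k (pi ^+ j * residue_repr (k := (k - j)%N) b).
have g_inj : injective g.
  move=> a b /residue_eq; rewrite -mulrBr -[k in maxideal_pow k](subnKC jk).
  by rewrite uniformizer_expM => /residue_eq; rewrite !residue_reprK.
rewrite -(card_codom g_inj); apply: eq_card => y; rewrite inE.
apply/asboolP/codomP => [[t ->]|[b ->]]; last first.
  by exists (residue k (residue_repr (k := (k - j)%N) b)); rewrite -rmorphM.
exists (residue (k - j) (residue_repr (k := k) t)).
rewrite -[t in LHS](residue_reprK (k := k)) -rmorphM; apply/residue_eq.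
rewrite -mulrBr -[k in maxideal_pow k](subnKC jk) uniformizer_expM.
by apply/residue_eq; rewrite residue_reprK.
Qed.

(* A [c i] of maximal absolute value generates the ideal; [c i0] only serves to
   make that maximum at least [q ^- k]. *)
Lemma card_residue_ideal (F : realType) (I : finType) (J : {set I}) (c : I -> o)
    (i0 : I) k (u : o) : i0 \in J -> u \is a GRing.unit -> c i0 = pi ^+ k * u ->
  (#|[set y : R k | `[< exists z : I -> R k,
      y = \sum_(i in J) residue k (c i) * z i >]]%SET|%:R : F) =
  q%:R ^+ k * \big[Num.max/0]_(i in J) absv F (c i).
Proof.
move=> i0J uu c0.
have q1 : 1 < q%:R :> F by rewrite ltr1n residue_card_gt1.
have q0 : 0 < q%:R :> F by rewrite (lt_trans ltr01).
have absv_ge0 x : 0 <= absv F x.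
  by rewrite /absv; case: ifP => // _; rewrite invr_ge0 exprn_ge0 ?ltW.
have [i1 i1J i1max] := arg_maxP (fun i => absv F (c i)) i0J.
(* Hence [c i1] is nonzero and its valuation [j] is at most [k], as [card_residue_principal]
   requires. *)
have qk : (q%:R : F) ^- k <= absv F (c i1).
  by have := i1max _ i0J; rewrite c0 absv_expM.
have c1 : c i1 != 0.
  apply: contraTneq qk => ->; rewrite /absv eqxx -ltNge invr_gt0.
  exact: exprn_gt0.
have [j [v [vu c1E]]] := dvr_decomp c1.
have qV l l' : ((q%:R : F) ^- l <= q%:R ^- l') = (l' <= l)%N.
  by rewrite lef_pV2 ?posrE ?exprn_gt0// ler_eXn2l.
have jk : (j <= k)%N by rewrite -qV -[X in _ <= X](absv_expM F j vu) -c1E.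
have -> : \big[Num.max/0]_(i in J) absv F (c i) = q%:R ^- j.
  rewrite -(absv_expM F j vu) -c1E; apply/le_anti/andP; split.
    by apply/bigmax_leP; split.
  exact: le_bigmax_cond.
rewrite -expfB_cond; last by rewrite gt_eqF.
rewrite -natrX -card_residue_principal//; congr (_%:R).
apply: eq_card => y; rewrite !inE; apply/asboolP/asboolP => -[z ->]; last first.
  exists (fun i => if i == i1 then residue k v^-1 * z else 0).
  rewrite (bigD1 i1)//= eqxx big1 ?addr0; last first.
    by move=> i /andP[_ /negPf ->]; rewrite mulr0.
  by rewrite c1E mulrA -rmorphM mulrK.
(* By maximality of [c i1], every other [c i] has valuation at least [j]. *)
have /choice[r rE] i : exists r, i \in J -> c i = pi ^+ j * r.
  have [iJ|] := boolP (i \in J); last by exists 0.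
  have [->|ci] := eqVneq (c i) 0; first by exists 0; rewrite mulr0.
  have [l [w [wu cE]]] := dvr_decomp ci.
  have : absv F (c i) <= absv F (c i1) by exact: i1max.
  rewrite cE c1E !absv_expM// qV => jl.
  by exists (pi ^+ (l - j) * w); rewrite mulrA -exprD subnKC.
exists (\sum_(i in J) residue k (r i) * z i); rewrite mulr_sumr.
by apply: eq_bigr => i /rE ->; rewrite rmorphM mulrA.
Qed.

End DiscreteValuationRing.

(** * Average sizes of kernels *)

Section KernelCounting.

(** Every non-empty fibre of [f] is a coset [u0 + ker f]. *)
Lemma card_kernel_image (U W : finZmodType) (f : {additive U -> W}) :
  (#|[set u | f u == 0%R]%SET| * #|[set f u | u : U]%SET| = #|U|)%N.
Proof.
rewrite -[RHS]sum1_card (partition_big_imset f) /= mulnC.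
rewrite -sum_nat_const; apply: eq_bigr => w /imsetP[u0 _ ->].
rewrite sum1dep_card -[LHS](card_imset _ (addrI u0)); apply: eq_card => u.
rewrite [RHS]inE; apply/imsetP/eqP => [[t + ->]|fu].
  by rewrite inE raddfD => /eqP ->; rewrite addr0.
by exists (u - u0); rewrite ?inE ?raddfB ?fu ?subrr// addrC subrK.
Qed.

Lemma card_rV_family (S : finType) n (I : 'I_n -> {set S}) :
  #|[set w : 'rV[S]_n | [forall c, w 0 c \in I c]]%SET| = (\prod_c #|I c|)%N.
Proof.
pose g (w : {ffun 'I_n -> S}) : 'rV[S]_n := \row_c w c.
have g_inj : injective g by move=> w w' /rowP gw; apply/ffunP => c; have := gw c; rewrite !mxE.
have -> : (\prod_c #|I c|)%N = #|family I|.
  by rewrite card_family foldrE big_map -big_enum.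
rewrite -(card_imset _ g_inj); apply: eq_card => w; rewrite inE.
apply/forallP/imsetP => [wI|[f /familyP fI ->] c]; last by rewrite mxE.
exists [ffun c => w 0 c]; last by apply/rowP => c; rewrite mxE ffunE.
by apply/familyP => c; rewrite ffunE.
Qed.

Variables (K : fieldExtType rat) (d : nat) (A : arrangement K d).
Variables (mu : flat A -> nat) (A_homog : homogeneous A).
Variables (T : pzRingType) (phi : {rmorphism OK K -> T}).
Variables (S : finComPzRingType) (psi : {rmorphism T -> S}).

Definition form_value (H : hyp A) (v : 'rV[S]_d) : S :=
  \sum_j psi (phi (aff_lin (Defs.form H) 0 j)) * v 0 j.

(** The ideal I_x(v) of the overview. Coefficients are indexed by all of [hyp A], which avoids a
    dependent index type. *)
Definition flat_ideal (x : flat A) (v : 'rV[S]_d) : {set S} :=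
  [set y | `[< exists z : hyp A -> S,
    y = \sum_(H in hyps_over x) form_value H v * z H >]]%SET.

Let M : 'M['rV[T]_#|{: var_index mu}|]_(d, #|{: mu_index mu}|) :=
  map_mx (map_mx phi) (mu_matrix mu).

(** Only the variables Z_(H, e) with e the index of [c] occur in column [c]; this is the source of
    the independence of the columns. *)
Lemma mulmx_mu_matrix (v : 'rV[S]_d) (z : 'rV[S]_#|{: var_index mu}|) c :
  (v *m lfmx_eval psi M z) 0 c =
  \sum_(H : {H : hyp A | H \in hyps_over (tag (enum_val c))})
    form_value (val H) v *
    z 0 (enum_rank (existT (fun e : mu_index mu => {H : hyp A | H \in hyps_over (tag e)})
                     (enum_val c) H : var_index mu)).
Proof.
have lin (H : hyp A) j : aff_eval id (Defs.form H) (delta_mx 0 j) = aff_lin (Defs.form H) 0 j.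
  rewrite /aff_eval A_homog add0r (bigD1 j)//= mxE !eqxx mulr1 big1 ?addr0//.
  by move=> i /negPf ij; rewrite mxE ij mulr0.
rewrite mxE; under eq_bigr => j _.
  rewrite !mxE /lf_eval; under eq_bigr => i _.
    rewrite mxE summxE !rmorph_sum mulr_suml /=; under eq_bigr => H _.
      by rewrite lin !mxE /= !rmorphM; over.
    over.
  rewrite exchange_big /=; under eq_bigr => H _.
    (* A [Zvar] has a single nonzero coefficient, which selects one term of the sum over [i]. *)
    rewrite (bigD1 (enum_rank (existT (fun e : mu_index mu =>
      {H : hyp A | H \in hyps_over (tag e)}) (enum_val c) H : var_index mu)))//=.
    rewrite eqxx !rmorph1 mulr1 big1 ?addr0; last first.
      by move=> i /negPf ->; rewrite !rmorph0 mulr0 mul0r.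
    over.
  rewrite mulr_sumr; over.
rewrite exchange_big /=; apply: eq_bigr => H _; rewrite mulr_suml.
by apply: eq_bigr => j _; rewrite mulrA [v 0 j * _]mulrC.
Qed.

Lemma image_mu_matrix (v : 'rV[S]_d) :
  [set v *m lfmx_eval psi M z | z : 'rV[S]_#|{: var_index mu}|]%SET =
  [set w : 'rV[S]_#|{: mu_index mu}| | [forall c, w 0 c \in flat_ideal (tag (enum_val c)) v]]%SET.
Proof.
apply/setP => w; rewrite inE; apply/imsetP/forallP => [[z _ ->] c|wI].
  rewrite inE mulmx_mu_matrix; apply/asboolP.
  (* The variables of column [c], extended by zero to the hyperplanes outside [hyps_over]. *)
  pose g (H : hyp A) : S :=
    if insub H is Some H' then
      z 0 (enum_rank (existT (fun e : mu_index mu => {H : hyp A | H \in hyps_over (tag e)})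
                     (enum_val c) H' : var_index mu)) else 0.
  exists g; rewrite [RHS](reindex_omap (val : {H : hyp A | H \in hyps_over (tag (enum_val c))} -> _) insub); last first.
    by move=> H Hc; rewrite insubT.
  apply: eq_big => [H|H _]; first by rewrite valK eqxx andbT (valP H).
  by rewrite /g valK.
have /choice[z zE] c : exists z : hyp A -> S,
    w 0 c = \sum_(H in hyps_over (tag (enum_val c))) form_value H v * z H.
  by have := wI c; rewrite inE => /asboolP.
(* Each variable belongs to exactly one column, so the coefficients chosen column by column combine
   into one vector. *)
exists (\row_i z (enum_rank (tag (enum_val i))) (val (tagged (enum_val i)))) => //.
apply/rowP => c; rewrite mulmx_mu_matrix zE.
rewrite [LHS](reindex_omap (val : {H : hyp A | H \in hyps_over (tag (enum_val c))} -> _) insub); last first.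
  by move=> H Hc; rewrite insubT.
apply: eq_big => [H|H _]; first by rewrite valK eqxx andbT (valP H).
by rewrite mxE enum_rankK /= enum_valK.
Qed.

Lemma prod_mu_index (F : comPzSemiRingType) (g : flat A -> F) :
  \prod_(c < #|{: mu_index mu}|) g (tag (enum_val c)) = \prod_x g x ^+ mu x.
Proof.
rewrite -(big_enum_val (fun e : mu_index mu => g (tag e))) /=.
under [RHS]eq_bigr => x _ do
  rewrite -[mu x]card_ord -prodr_const.
by rewrite sig_big_dep; apply: eq_big => e; rewrite ?inE.
Qed.

(** Here [v] is fixed and [z] varies: [card_kernel_image] applies to the additive map sending z to v
    A(z). *)
Lemma card_mu_matrix_kernel (v : 'rV[S]_d) :
  (#|[set z : 'rV[S]_#|{: var_index mu}| | v *m lfmx_eval psi M z == 0%R]%SET| *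
   \prod_c #|flat_ideal (tag (enum_val (c : 'I_#|{: mu_index mu}|))) v|)%N =
  (#|S| ^ #|{: var_index mu}|)%N.
Proof.
have fB : zmod_morphism (fun z => v *m lfmx_eval psi M z).
  move=> z z'; rewrite -mulmxBr; congr (_ *m _); apply/matrixP => i j.
  rewrite !mxE /lf_eval -sumrB; apply: eq_bigr => l _.
  by rewrite !mxE -mulrBr.
pose f : {additive 'rV[S]_#|{: var_index mu}| -> 'rV[S]_#|{: mu_index mu}|} :=
  HB.pack (fun z => v *m lfmx_eval psi M z) (GRing.isZmodMorphism.Build _ _ _ fB).
rewrite -card_rV_family -image_mu_matrix (card_kernel_image f).
by rewrite card_mx mul1n.
Qed.

Lemma askE (F : realType) :
  ask F psi M = \sum_(v : 'rV[S]_d) \prod_(x : flat A) (#|flat_ideal x v|%:R : F) ^- mu x.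
Proof.
have S0 : (#|S|%:R : F) != 0.
  by rewrite pnatr_eq0 -lt0n; apply/card_gt0P; exists 0.
have ideal0 x v : (#|flat_ideal x v|%:R : F) != 0.
  rewrite pnatr_eq0 -lt0n; apply/card_gt0P; exists 0; rewrite inE; apply/asboolP.
  by exists (fun=> 0); rewrite big1// => H _; rewrite mulr0.
rewrite /ask ncardT fsbig_finType; under eq_bigr => z _.
  rewrite ncardE -sum1dep_card natr_sum big_mkcond /=; over.
rewrite exchange_big mulr_sumr; apply: eq_bigr => v _.
(* The total number of [z] is replaced by its factorisation, and the kernel size then cancels; it is
   nonzero since [z = 0] is counted. *)
have /(congr1 (fun n => n%:R : F)) := card_mu_matrix_kernel v.
rewrite -big_mkcond sumr_const natrM natr_prod natrX.
rewrite (prod_mu_index (fun x => #|flat_ideal x v|%:R : F)) => <-.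
rewrite invfM mulrAC prodfV -[RHS]mul1r; congr (_ * _).
rewrite -[X in _ * (1 *+ X)](_ : #|[set z : 'rV[S]_#|{: var_index mu}| |
    v *m lfmx_eval psi M z == 0]%SET| = _).
  rewrite mulVf// pnatr_eq0 -lt0n; apply/card_gt0P; exists 0; rewrite inE.
  apply/eqP/rowP => c; rewrite mulmx_mu_matrix// mxE big1// => H _.
  by rewrite mxE mulr0.
by apply: eq_card => z; rewrite inE; apply/eqP/asboolP.
Qed.
End KernelCounting.

(** * Haar measure of boxes and shells *)

Section CompactDiscreteValuationRing.
Variables (o : topIdomainType) (o_cdvr : is_compact_dvr o).

Lemma maxideal_coset_open k (x : o) : open [set y | y - x \in maxideal_pow k].
Proof.
rewrite openE => y /= yx; rewrite /interior cdvr_nbhs//; exists k => // z /= zy.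
by rewrite -(subrK y z) -addrA rpredD.
Qed.

(** The cosets of p^k form an open cover indexed by the residue ring. They are pairwise disjoint, so
    a finite subcover contains all of them. *)
Lemma compact_dvr_residue_finite k : finite_set [set: residue_ring o k].
Proof.
pose o' : ptopologicalType := HB.pack (TopIdomain.sort o) (TopIdomain.class o)
  (isPointed.Build o 0).
have : @cover_compact o' setT by rewrite -compact_cover; exact: cdvr_compact.
move=> /(_ (residue_ring o k) setT (fun a => [set y | y - residue_repr a \in maxideal_pow k])).
case=> [a _|x _|D _ Dcover]; first exact: maxideal_coset_open.
  by exists (residue k x) => //=; apply/residue_eq; rewrite residue_reprK.
rewrite (_ : setT = [set` D]); first exact: finite_fset.
apply/seteqP; split=> // a _; have [b bD /= /residue_eq] := Dcover (residue_repr a) I.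
by rewrite !residue_reprK => ->.
Qed.

Variables (pi : o) (pi0 : pi != 0).
Hypothesis piP : forall x : o, maxideal x <-> exists r, x = pi * r.
Let o_dvr := cdvr_dvr o_cdvr.
Let R k : finComPzRingType := finite_ring (compact_dvr_residue_finite k).
Let q := residue_card o.

Section Boxes.
Variables (n : nat).

(** The radius may depend on the coordinate, so that coordinate 0 can be refined alone. *)
Definition box (l : 'I_n -> nat) (a : 'rV[o]_n) : set (borel o n) :=
  [set v | forall j, (v : 'rV[o]_n) 0 j - a 0 j \in maxideal_pow (l j)].

Lemma box_measurable l a : measurable (box l a).
Proof.
apply: sub_sigma_algebra; rewrite /= openE => v va; rewrite /interior.
exists (fun i j => [set y | y - (v : 'rV[o]_n) i j \in maxideal_pow (l j)]) => [i j|w wv j].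
  by rewrite cdvr_nbhs//; exists (l j).
rewrite -(subrK ((v : 'rV[o]_n) 0 j) ((w : 'rV[o]_n) 0 j)) -addrA rpredD//.
exact: wv.
Qed.

Variables (F : realType) (P : probability (borel o n) F) (P_haar : is_haar P).

Lemma haar_box l a : P (box l a) = P (box l 0).
Proof.
rewrite -(P_haar a (box_measurable l 0)); congr (P _).
apply/seteqP; split=> [v va|_ [v v0 <-] j].
  exists ((v : 'rV[o]_n) - a); last by rewrite addrC subrK.
  by move=> j; have := va j; rewrite !mxE subr0.
by have := v0 j; rewrite !mxE subr0 addrAC subrr add0r.
Qed.

Lemma haar_box_partition (I : finType) (E : set (borel o n)) l (t : I -> 'rV[o]_n) :
  (forall v, E v <-> exists i, box l (t i) v) ->
  (forall i j v, box l (t i) v -> box l (t j) v -> i = j) ->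
  P E = (#|I|%:R%:E * P (box l 0))%E.
Proof.
move=> EE disj; have -> : E = \bigcup_(i in [set: I]) box l (t i).
  by apply/seteqP; split=> v => [/EE[i iv]|[i _ iv]]; [exists i|apply/EE; exists i].
rewrite measure_fin_bigcup//; last 3 first.
- exact: finite_finset.
- by move=> i j _ _ [v [iv jv]]; exact: disj iv jv.
- by move=> i _; exact: box_measurable.
rewrite fsbig_finType (eq_bigr (fun=> P (box l 0))) => [|i _]; last exact: haar_box.
have := fin_num_measure P (box l 0) (box_measurable l 0).
move=> /fineK <-; rewrite sumEFin sumr_const -EFinM; congr EFin.
by rewrite mulr_natl.
Qed.

(** The whole space has mass 1 and is the disjoint union of q^(k n) translates of the cube. *)
Lemma haar_cube k a : P (box (fun=> k) a) = ((q%:R ^- (k * n))%:E)%E.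
Proof.
have q0 : (q%:R : F) != 0.
  by rewrite pnatr_eq0 -lt0n (ltn_trans _ (residue_card_gt1 pi0 piP compact_dvr_residue_finite)).
pose t (b : 'rV[R k]_n) := \row_j residue_repr (k := k) (b 0 j).
have t_cover (v : borel o n) : setT v <-> exists b, box (fun=> k) (t b) v.
  split=> // _; exists (\row_j (residue k ((v : 'rV[o]_n) 0 j))) => j.
  by rewrite !mxE; apply/residue_eq; rewrite residue_reprK.
have t_disj b b' v : box (fun=> k) (t b) v -> box (fun=> k) (t b') v -> b = b'.
  move=> bv b'v; apply/rowP => j; have := bv j; have := b'v j; rewrite !mxE.
  by move=> /residue_eq + /residue_eq; rewrite !residue_reprK => -> ->.
have := haar_box_partition t_cover t_disj.
rewrite haar_box probability_setT card_mx (card_residue pi0 piP) mul1n.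
have := fin_num_measure P (box (fun=> k) 0) (box_measurable _ 0).
move=> /fineK <-; rewrite -expnM -natrX natrX -EFinM => -[e].
by congr EFin; apply: (mulfI (expf_neq0 (k * n) q0)); rewrite -e mulfV// expf_neq0.
Qed.

(** Fixing the next pi-adic digit of coordinate [j0] cuts the box into q translates of the smaller
    one. *)
Lemma haar_box_succ l j0 :
  P (box l 0) = (q%:R%:E * P (box (fun j => (l j + (j == j0))%N) 0))%E.
Proof.
set l' := fun j => _.
pose t (b : R 1%N) : 'rV[o]_n :=
  \row_j if j == j0 then pi ^+ l j0 * residue_repr (k := 1) b else 0.
have t_cover (v : borel o n) : box l 0 v <-> exists b, box l' (t b) v.
  split=> [v0|[b vb] j]; last first.
    have := vb j; rewrite !mxE subr0 /l'; have [->|_] := eqVneq j j0; last first.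
      by rewrite subr0 addn0.
    move=> /(maxideal_pow_le piP (leq_addr _ _)) /rpredD vl.
    rewrite -(subrK (pi ^+ l j0 * residue_repr (k := 1) b) ((v : 'rV[o]_n) 0 j0)).
    by apply: vl; apply/(maxideal_powP piP); eexists.
  have := v0 j0; rewrite mxE subr0 => /(maxideal_powP piP)[c cE].
  exists (residue 1 c) => j; rewrite mxE /l'; have [->|_] := eqVneq j j0; last first.
    by have := v0 j; rewrite mxE addn0.
  rewrite cE -mulrBr (uniformizer_expM pi0 piP); apply/residue_eq.
  by rewrite residue_reprK.
have t_disj b b' v : box l' (t b) v -> box l' (t b') v -> b = b'.
  move=> /(_ j0) bv /(_ j0) b'v; have := rpredB b'v bv; rewrite !mxE eqxx /l' eqxx.
  rewrite opprB addrC subrKA -mulrBr (uniformizer_expM pi0 piP) => /residue_eq.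
  by rewrite !residue_reprK.
rewrite (haar_box_partition t_cover t_disj) (card_residue pi0 piP).
by rewrite expn1.
Qed.

End Boxes.

Section Shells.
Variable d : nat.

Definition shell k (a : 'rV[R k]_d) : set (borel o d.+1) :=
  [set v | [/\ (v : 'rV[o]_d.+1) 0 0 \in maxideal_pow k,
    (v : 'rV[o]_d.+1) 0 0 \notin maxideal_pow k.+1 &
    forall i, residue k ((v : 'rV[o]_d.+1) 0 (lift 0 i)) = a 0 i]].

Definition shell_center k (a : 'rV[R k]_d) : 'rV[o]_d.+1 :=
  \row_j oapp (fun i => residue_repr (k := k) (a 0 i)) 0 (unlift 0 j).

(** Requiring v_0 to have valuation exactly k removes from a cube the sub-box where v_0 lies in
    p^(k+1). This reduces measurability and measure to boxes. *)
Lemma shellE k (a : 'rV[R k]_d) : shell a =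
  box (fun=> k) (shell_center a) `\`
  box (fun j => k + (j == ord0))%N (shell_center a).
Proof.
have center0 : shell_center a 0 0 = 0 by rewrite mxE unlift_none.
have centerS i : shell_center a 0 (lift 0 i) = residue_repr (k := k) (a 0 i).
  by rewrite mxE liftK.
apply/seteqP; split=> v /=.
  move=> [v0 v1 va]; split=> [j|].
    case: (unliftP 0 j) => [i|] ->; last by rewrite center0 subr0.
    by rewrite centerS; apply/residue_eq; rewrite va residue_reprK.
  by move=> /(_ 0); rewrite center0 subr0 eqxx addn1; exact/negP.
move=> [vk vk1]; have va i : residue k ((v : 'rV[o]_d.+1) 0 (lift 0 i)) = a 0 i.
  rewrite -[RHS](residue_reprK (k := k)); apply/residue_eq.
  by rewrite -centerS; exact: vk.
split=> //; first by have := vk 0; rewrite center0 subr0.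
apply/negP => v1; apply: vk1 => j; case: (unliftP 0 j) => [i|] ->.
  by rewrite /= addn0; exact: vk.
by rewrite center0 subr0 eqxx addn1.
Qed.

Lemma shell_measurable k (a : 'rV[R k]_d) : measurable (shell a).
Proof. by rewrite shellE; apply: measurableD; exact: box_measurable. Qed.

(** The removed sub-box has 1/q times the measure of the cube. *)
Lemma haar_shell (F : realType) (P : probability (borel o d.+1) F)
    (P_haar : is_haar P) k (a : 'rV[R k]_d) :
  P (shell a) = (q%:R ^- (k * d.+1) * (1 - q%:R^-1))%:E%E.
Proof.
have q0 : (q%:R : F) != 0.
  by rewrite pnatr_eq0 -lt0n (ltn_trans _ (residue_card_gt1 pi0 piP compact_dvr_residue_finite)).
transitivity (P (box (fun=> k) (shell_center a)) -
    P (box (fun j => k + (j == ord0))%N (shell_center a)))%E.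
  rewrite shellE measureD; try exact: box_measurable.
    rewrite setIidr// => v vk1 j.
    exact: (maxideal_pow_le piP (leq_addr (j == ord0) k)).
  by rewrite ltey_eq fin_num_measure//; exact: box_measurable.
rewrite (haar_box P_haar (fun j => k + (j == ord0))%N) haar_cube//.
have := haar_box_succ P_haar (fun=> k) 0; rewrite haar_cube//.
have := fin_num_measure P (box (fun j => (k + (j == ord0))%N) 0) (box_measurable _ 0).
move=> /fineK <-; rewrite -EFinM -EFinB => -[e]; congr EFin.
by rewrite mulrBr mulr1 [in RHS]mulrC [X in _ = _ - _ * X]e mulKf.
Qed.

Lemma shell_disjoint k l (a : 'rV[R k]_d) (b : 'rV[R l]_d) v :
  shell a v -> shell b v -> k = l.
Proof.
move=> [ak ak1 _] [bl bl1 _]; case: (ltngtP k l) => // kl.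
  by rewrite (maxideal_pow_le piP kl bl) in ak1.
by rewrite (maxideal_pow_le piP kl ak) in bl1.
Qed.

Lemma shell_disjoint_level k (a b : 'rV[R k]_d) v :
  shell a v -> shell b v -> a = b.
Proof. by move=> [_ _ av] [_ _ bv]; apply/rowP => i; rewrite -av -bv. Qed.

Lemma shell_cover (v : 'rV[o]_d.+1) : v 0 0 != 0 -> exists k (a : 'rV[R k]_d), shell a v.
Proof.
move=> /(dvr_decomp o_dvr pi0 piP)[k [u [uu vE]]].
exists k, (\row_i residue k (v 0 (lift 0 i))); split=> [||i]; last by rewrite mxE.
  by rewrite vE (uniformizer_exp_unit pi0 piP).
by rewrite vE (uniformizer_exp_unit pi0 piP)// ltnn.
Qed.

Lemma shell0 k (a : 'rV[R k]_d) (v : 'rV[o]_d.+1) : shell a v ->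
  exists2 u, u \is a GRing.unit & v 0 0 = pi ^+ k * u.
Proof.
case=> /(maxideal_powP piP)[u uE] vk1 _; exists u => //.
apply/negPn/negP => /piP[c cE]; move/negP: vk1; apply.
by apply/(maxideal_powP piP); exists c; rewrite uE cE exprSr mulrA.
Qed.

End Shells.

End CompactDiscreteValuationRing.

(** * Integration of functions constant on countably many pieces *)

Section StepFunctions.
Variables (d : measure_display) (T : measurableType d) (F : realType).
Variables (P : probability T F) (I : nat -> finType).
Variables (D : forall k, I k -> set T) (c : forall k, I k -> F) (g : T -> F).
Arguments D : clear implicits.
Arguments c : clear implicits.

Let C k := \big[setU/set0]_(a <- enum (I k)) D k a.

Hypothesis D_measurable : forall k a, measurable (D k a).
Hypothesis D_disjoint : forall k l a b v, D k a v -> D l b v -> k = l.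
Hypothesis D_disjoint_level : forall k a b v, D k a v -> D k b v -> a = b.
Hypothesis gE : forall k a v, D k a v -> g v = c k a.
Hypothesis g0 : forall v, (forall k a, ~ D k a v) -> g v = 0.
Hypothesis c_bounded : forall k a, `|c k a| <= 1.

Let mem_C k v : C k v <-> exists a, D k a v.
Proof.
rewrite /C -bigcup_seq; split=> [[a _ Da]|[a Da]]; first by exists a.
by exists a => //=; rewrite mem_enum.
Qed.

Let C_measurable k : measurable (C k).
Proof. by apply: bigsetU_measurable. Qed.

Let C_trivIset : trivIset setT C.
Proof.
by move=> k l _ _ [v [/mem_C[a Da] /mem_C[b Db]]]; exact: D_disjoint Da Db.
Qed.

Lemma step_function_measurable : measurable_fun setT g.
Proof.
move=> _ Y _; rewrite setTI.
(* Off all pieces [g] is 0, so the complement enters exactly when 0 lies in [Y]. *)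
have -> : g @^-1` Y =
    \bigcup_k \bigcup_(a in [set a | Y (c k a)]) D k a `|`
    (if `[< Y 0 >] then ~` \bigcup_k C k else set0).
  apply/seteqP; split=> v /=.
    move=> Yv; have [[k [a Da]]|h] := pselect (exists k a, D k a v).
      by left; exists k => //; exists a => //=; rewrite -(gE Da).
    right; rewrite -(g0 (v := v)); last by move=> k a Da; apply: h; exists k, a.
    by rewrite asboolT// => -[k _ /mem_C[a Da]]; apply: h; exists k, a.
  move=> [[k _ [a Ya Da]]|]; first by rewrite (gE Da).
  case: asboolP => // Y0 h; rewrite g0// => k a Da; apply: h; exists k => //.
  by apply/mem_C; exists a.
apply: measurableU.
  apply: bigcupT_measurable => k; apply: fin_bigcup_measurable => //.
by case: ifP => // _; apply: measurableC; exact: bigcupT_measurable.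
Qed.

Let g_bounded v : `|g v| <= 1.
Proof.
have [[k [a Da]]|h] := pselect (exists k a, D k a v); first by rewrite (gE Da).
by rewrite g0 ?normr0// => k a Da; apply: h; exists k, a.
Qed.

(** A measurable function bounded by 1 on a probability space is integrable; summability over the
    levels is then a consequence. *)
Lemma step_function_integrable : P.-integrable setT (EFin \o g).
Proof.
apply: measurable_bounded_integrable => //.
- exact: le_lt_trans (probability_le1 P measurableT) (ltry _).
- exact: step_function_measurable.
by exists 1; split => // M M1 v _; apply: le_trans (g_bounded v) _; exact: ltW.
Qed.

Let integral_level k :
  (\int[P]_(v in C k) (g v)%:E = (\sum_a c k a * fine (P (D k a)))%:E)%E.
Proof.
rewrite integral_bigsetU_EFin//=; last 3 first.
- exact: enum_uniq.
- by move=> a b _ _ [v [Da Db]]; exact: D_disjoint_level Da Db.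
- apply/measurable_realfun.measurable_EFinP.
  exact: measurable_funS step_function_measurable.
rewrite big_enum -sumEFin; apply: eq_bigr => a _.
under eq_integral => v /set_mem Dv do rewrite (gE Dv).
by rewrite integral_cst// EFinM fineK// fin_num_measure.
Qed.

Lemma step_function_integral :
  series (fun k => \sum_a c k a * fine (P (D k a))) @ \oo --> (\int[P]_v g v)%R.
Proof.
have gC : (\int[P]_v (g v)%:E = \int[P]_(v in \bigcup_k C k) (g v)%:E)%E.
  rewrite [RHS]integral_mkcond; apply: eq_integral => v _; rewrite patchE.
  case: ifPn => // /negP vC; rewrite g0// => k a Da; apply: vC; apply/mem_set.
  by exists k => //; apply/mem_C; exists a.
have intC : P.-integrable (\bigcup_k C k) (EFin \o g).
  apply: integrableS step_function_integrable => //.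
  exact: bigcupT_measurable.
have sumE : (\int[P]_v (g v)%:E =
    \sum_(k <oo) (\sum_a c k a * fine (P (D k a)))%:E)%E.
  rewrite gC integral_bigcup//; apply: eq_eseriesr => k _.
  exact: integral_level.
have fin : (\int[P]_v (g v)%:E \is a fin_num)%E.
  exact: integrable_fin_num step_function_integrable.
pose t k : F := \sum_a c k a * fine (P (D k a)).
(* Integrability makes the level integrals absolutely summable, so the sum in the extended reals is
   the limit of a real series. *)
have t_summable : summable setT (fun k => `|t k|%:E).
  have := integrable_summable C_trivIset C_measurable intC.
  rewrite /summable; congr (_ < _)%E; apply: eq_esum => k _.
  by rewrite integral_level /= normr_id.
have t_cvg : cvgn (series t).
  apply: normed_cvg.
  have /= := @summable_cvg F xpredT (fun k => `|t k|%:E); apply.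
    by move=> k _; rewrite lee_fin.
  by rewrite [X in summable X _](_ : _ = setT)//; apply/seteqP; split.
rewrite /Rintegral sumE (_ : (\sum_(k <oo) _)%E = (limn (series t))%:E)//.
by rewrite -EFin_lim//; apply/congr_lim/funext => n /=; rewrite /series /= -sumEFin.
Qed.

End StepFunctions.

(** * Flats of the cone *)

Section ConeFlats.

Lemma aff_eval_homogenise (R S : pzRingType) (phi : {rmorphism R -> S}) d
    (L : affine_form R d) (v : 'rV[S]_d.+1) :
  aff_eval phi (homogenise L) v =
  phi (aff_const L) * v 0 0 + \sum_j phi (aff_lin L 0 j) * v 0 (lift 0 j).
Proof.
rewrite /aff_eval rmorph0 add0r big_ord_recl; congr (_ + _).
  rewrite mxE; case: splitP => // k _; by rewrite ord1 mxE eqxx mulr1n.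
apply: eq_bigr => j _; congr (phi _ * _); rewrite mxE; case: splitP => k /=.
  by rewrite ord1 /bump.
by rewrite /bump /= !add1n => -[jk]; congr (aff_lin L 0 _); apply/val_inj.
Qed.

Lemma aff_eval_coordX0 (R S : pzRingType) (phi : {rmorphism R -> S}) d
    (v : 'rV[S]_d.+1) :
  aff_eval phi (coordX0 R d) v = v 0 0.
Proof.
rewrite /aff_eval rmorph0 add0r big_ord_recl !mxE !eqxx rmorph1 mul1r.
by rewrite big1 ?addr0// => j _; rewrite !mxE /= rmorph0 mul0r.
Qed.

Variables (K : fieldExtType rat) (d : nat) (A : arrangement K d).
Hypothesis A_homog : homogeneous A.

Let hyperplane_Some (H : hyp A) (v : 'rV[K]_d.+1) :
  hyperplane (A := cone A) (Some H) v <-> hyperplane H (\row_j v 0 (lift 0 j)).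
Proof.
rewrite /hyperplane /zero_locus /= aff_eval_homogenise A_homog rmorph0 mul0r add0r.
by rewrite /aff_eval A_homog rmorph0 add0r; under [in X in _ <-> X]eq_bigr do rewrite mxE.
Qed.

Let hyperplane_None (v : 'rV[K]_d.+1) :
  hyperplane (A := cone A) None v <-> v 0 0 = 0.
Proof. by rewrite /hyperplane /zero_locus /= aff_eval_coordX0. Qed.

(** As the forms are homogeneous, [underline x] is {0} x x in K x K^d, and the cone of a hyperplane
    H does not see coordinate 0. Testing on the points (0, v) with v in x shows that no further
    hyperplane contains it. *)
Lemma hyps_over_underline (x : flat A) :
  hyps_over (underline x) = (None |: Some @: hyps_over x)%SET.
Proof.
apply/setP => H; rewrite inE; apply/asboolP/idP => [xH|HJ v /(_ H)]; last exact.
case: H xH => [H|_]; last by rewrite !inE.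
move=> xH; rewrite !inE /=; apply/imsetP; exists H => //; rewrite inE; apply/asboolP.
move=> v xv; pose v' : 'rV[K]_d.+1 := \row_j oapp (fun i => v 0 i) 0 (unlift 0 j).
have v'E : \row_j v' 0 (lift 0 j) = v by apply/rowP => j; rewrite !mxE liftK.
rewrite -v'E; apply/hyperplane_Some/xH; rewrite /underline /= => H' /=.
rewrite !inE => /orP[/eqP ->|/imsetP[H'' + ->]].
  by apply/hyperplane_None; rewrite mxE unlift_none.
by rewrite inE => /asboolP xH''; apply/hyperplane_Some; rewrite v'E; exact: xH''.
Qed.

Lemma underline_inj : injective (@underline K d A).
Proof.
move=> x y /(congr1 (@hyps_over _ _ _)); rewrite !hyps_over_underline => xy.
apply: hyps_over_inj; apply/setP => H; move/setP/(_ (Some H)): xy.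
by rewrite !in_setU1 /= !(mem_imset _ _ Some_inj).
Qed.

(** The preimage is cut out by those H whose cone contains [y]. One inclusion forgets coordinate 0,
    the other inserts a zero there. *)
Lemma underline_surj (y : flat (cone A)) : (cone_H0 A <= y)%O ->
  exists x, underline x = y.
Proof.
move=> /asboolP yH0; pose T : {set hyp A} := [set H | Some H \in hyps_over y]%SET.
have yNone : None \in hyps_over y.
  by rewrite inE; apply/asboolP => v /yH0; apply; rewrite /= inE.
exists (homogeneous_flat A_homog T); apply: hyps_over_inj.
rewrite hyps_over_underline; apply/setP => -[H|]; last by rewrite in_setU1 eqxx yNone.
rewrite in_setU1 /= (mem_imset _ _ Some_inj) !inE; apply/asboolP/asboolP => TH v vy.
  apply/hyperplane_Some/TH => H' /=; rewrite !inE => yH'.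
  by apply/hyperplane_Some; exact: yH'.
pose v' : 'rV[K]_d.+1 := \row_j oapp (fun i => v 0 i) 0 (unlift 0 j).
have v'E : \row_j v' 0 (lift 0 j) = v by apply/rowP => j; rewrite !mxE liftK.
rewrite -v'E; apply/hyperplane_Some/TH; rewrite -intersection_hyps_over.
case=> [H'|] /= yH'; last by apply/hyperplane_None; rewrite mxE unlift_none.
by apply/hyperplane_Some; rewrite v'E; apply: vy; rewrite /= inE.
Qed.

Lemma hyps_over_bot : hyps_over (\bot%O : flat A) = finset.set0.
Proof.
apply/setP => H; rewrite !inE; apply/negP => /asboolP h.
move/eqP: (form_deg1 H); apply; apply/rowP => j.
have : hyperplane H (delta_mx 0 j) by exact: h.
rewrite /hyperplane /zero_locus /= /aff_eval A_homog rmorph0 add0r (bigD1 j)//=.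
rewrite !mxE !eqxx mulr1 big1 ?addr0; last first.
  by move=> i /negPf ij; rewrite mxE ij mulr0.
by move=> Hj; exact: val_inj.
Qed.

Lemma underline_bot : underline (\bot%O : flat A) = cone_H0 A.
Proof.
apply: val_inj; rewrite /= hyps_over_bot; congr intersection.
by apply/setP => H; rewrite !inE imset0 inE orbF.
Qed.

Lemma cone_H0_neq_bot : cone_H0 A != \bot%O.
Proof.
apply/eqP => H0; have := cone_form_neq; have := @hyps_over_underline \bot%O.
rewrite underline_bot H0 => /setP/(_ None); rewrite !inE /= => /asboolP h.
suff : (1 : K) = 0 by move/eqP; rewrite oner_eq0.
have /hyperplane_None : hyperplane (A := cone A) None (delta_mx 0 0) by exact: h.
by rewrite mxE !eqxx.
Qed.

(** The flats of the cone above H_0 are indexed by those of [A], with H_0 itself coming from hat0;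
    it is split off because its exponent has a different form. *)
Lemma prod_cone_flats (V : comPzSemiRingType) (G : flat (cone A) -> V) :
  (forall y, ~~ (cone_H0 A <= y)%O -> G y = 1) ->
  \prod_(y : flat (cone A) | y != \bot%O) G y =
  G (cone_H0 A) * \prod_(x : flat A | x != \bot%O) G (underline x).
Proof.
move=> G1; rewrite (bigD1 (cone_H0 A) cone_H0_neq_bot)/=; congr (_ * _).
rewrite (bigID (mem [set underline x | x in [set x : flat A | x != \bot%O]]%SET))/=.
rewrite [X in _ * X]big1 ?mulr1; last first.
  move=> y /andP[/andP[_ yH0] ynim]; apply: G1; apply/negP => /underline_surj[x xy].
  move/negP: ynim; apply; apply/imsetP; exists x => //; rewrite inE.
  by apply: contraNneq yH0 => xbot; rewrite -xy xbot underline_bot.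
rewrite (eq_bigl (mem [set underline x | x in [set x : flat A | x != \bot%O]]%SET)).
  rewrite big_imset/=; last by move=> x y _ _; exact: underline_inj.
  by apply: eq_bigl => x; rewrite inE.
move=> y /=; apply: andb_idl => /imsetP[x]; rewrite inE => xbot ->.
have H0x : underline x != cone_H0 A by rewrite -underline_bot (inj_eq underline_inj).
rewrite H0x andbT; apply: contra xbot => /eqP xbot.
(* A flat [underline x] lies in H_0 and therefore is not the whole space. *)
have := hyps_over_underline x; rewrite xbot => /setP/(_ None); rewrite !inE /=.
move=> /asboolP h; exfalso.
have /hyperplane_None : hyperplane (A := cone A) None (delta_mx 0 0) by exact: h.
by rewrite mxE !eqxx => /eqP; rewrite oner_eq0.
Qed.

End ConeFlats.

(** * Complex powers and limits *)

Section ComplexExponential.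
Local Open Scope complex_scope.
Variable F : realType.

Definition cexp (z : F[i]) : F[i] :=
  (expR (complex.Re z))%:C * (cos (complex.Im z) +i* sin (complex.Im z)).

Lemma cexpD z w : cexp (z + w) = cexp z * cexp w.
Proof.
case: z w => [a b] [c e]; apply/eqP; rewrite eq_complex /= expRD cosD sinD.
by apply/andP; split; apply/eqP; ring.
Qed.

Lemma cexp_real r : cexp r%:C = (expR r)%:C.
Proof.
apply/eqP; rewrite eq_complex /= cos0 sin0.
by apply/andP; split; apply/eqP; ring.
Qed.

Lemma cpowE a s : 0 < a -> cpow a s = cexp (s * (ln a)%:C).
Proof.
move=> a0; rewrite /cpow (gt_eqF a0); have [->|_] := eqVneq s 0.
  by rewrite mul0r -[0]/(0%:C) cexp_real expR0.
rewrite /cexp; case: s => x y /=; congr (_ * _).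
  by congr (expR _)%:C; ring.
by congr (cos _ +i* sin _); ring.
Qed.

Lemma cpow_natN a n : 0 < a -> cpow a (- n%:R : F[i]) = (a ^- n)%:C.
Proof.
move=> a0; rewrite cpowE//.
have -> : - n%:R * (ln a)%:C = (- (n%:R * ln a))%:C :> F[i].
  by rewrite rmorphN rmorphM rmorph_nat mulNr.
by rewrite cexp_real expRN expRM_natl lnK.
Qed.

Lemma norm_cos_sin_le1 (x : F) : `|cos x| <= 1 /\ `|sin x| <= 1.
Proof.
by rewrite !ler_norml cos_geN1 cos_le1 sin_geN1 sin_le1.
Qed.

Lemma norm_Re_cexp_le z : `|complex.Re (cexp z)| <= expR (complex.Re z).
Proof.
rewrite /= mul0r subr0 normrM ger0_norm ?expR_ge0//.
by rewrite ler_piMr ?expR_ge0//; case: (norm_cos_sin_le1 (complex.Im z)).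
Qed.

Lemma norm_Im_cexp_le z : `|complex.Im (cexp z)| <= expR (complex.Re z).
Proof.
rewrite /= mul0r addr0 normrM ger0_norm ?expR_ge0//.
by rewrite ler_piMr ?expR_ge0//; case: (norm_cos_sin_le1 (complex.Im z)).
Qed.

Lemma norm_complex_le (z : F[i]) :
  `|z| <= (`|complex.Re z| + `|complex.Im z|)%:C.
Proof.
case: z => a b; rewrite normc_def lecR /=.
rewrite -[leRHS]ger0_norm ?addr_ge0// -sqrtr_sqr ler_wsqrtr//.
rewrite sqrrD !real_normK ?num_real// -addrA lerD2l lerDr.
by rewrite mulrn_wge0// mulr_ge0.
Qed.

Lemma cvg_complex (u : nat -> F[i]^o) (l : F[i]) :
  (fun n => complex.Re (u n)) @ \oo --> complex.Re l ->
  (fun n => complex.Im (u n)) @ \oo --> complex.Im l ->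
  u @ \oo --> (l : F[i]^o).
Proof.
move=> /cvgrPdist_lt ul_re /cvgrPdist_lt ul_im.
have ReImB (x y : F[i]) : complex.Re (x - y) = complex.Re x - complex.Re y /\
    complex.Im (x - y) = complex.Im x - complex.Im y by case: x y => [? ?] [? ?].
(* The tolerance is a complex number; being positive, it has zero imaginary part and positive real
   part. *)
apply/cvgrPdist_lt => -[e e'] e0.
have /andP[/eqP /= e'0 {}e0] : (0 == e') && (0 < e) by move: e0; rewrite ltcE /= eq_sym.
rewrite -e'0 -[e +i* 0]/(e%:C).
near=> n; apply: le_lt_trans (norm_complex_le _) _; rewrite ltcR.
rewrite (ReImB _ _).1 (ReImB _ _).2 (splitr e) ltrD//; near: n.
  by apply: ul_re; rewrite divr_gt0.
by apply: ul_im; rewrite divr_gt0.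
Unshelve. all: by end_near. Qed.

End ComplexExponential.

(** * Comparison of the two zeta functions *)

Section ConeIntegral.
Local Open Scope complex_scope.
Variables (F : realType) (K : fieldExtType rat) (d : nat) (A : arrangement K d).
Hypothesis A_homog : homogeneous A.
Variables (mu : flat A -> nat) (o : topIdomainType) (o_cdvr : is_compact_dvr o).
Variable phi : {rmorphism OK K -> o}.
Variables (pi : o) (pi0 : pi != 0).
Hypothesis piP : forall x : o, maxideal x <-> exists r, x = pi * r.

Let o_dvr := cdvr_dvr o_cdvr.
Let R k : finComPzRingType := finite_ring (compact_dvr_residue_finite o_cdvr k).
Let red k : {rmorphism o -> R k} := (residue k : {rmorphism o -> residue_ring o k}).
Let q := residue_card o.
Let m := (\sum_(x : flat A) mu x)%N.
Let m' := (\sum_(x : flat A | x != \bot%O) mu x)%N.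

Let q_gt1 : (1 < q%:R :> F).
Proof.
by rewrite ltr1n (residue_card_gt1 pi0 piP (compact_dvr_residue_finite o_cdvr)).
Qed.

Let q_gt0 : (0 < q%:R :> F). Proof. exact: lt_trans q_gt1. Qed.

(** On the shell X_0 takes a value pi^k u with u a unit. It vanishes modulo p^k, so it does not
    enlarge the ideal, yet it keeps the maximum at least q^(-k) even if every L_H vanishes modulo
    p^k. This is what the cone is for. *)
Lemma card_flat_ideal k (a : 'rV[R k]_d) (x : flat A) (v : 'rV[o]_d.+1) :
  shell a v ->
  (#|flat_ideal phi (red k) x a|%:R : F) = q%:R ^+ k * arr_norm F phi (underline x) v.
Proof.
move=> av; have [u uu v0E] := shell0 piP av; case: av => _ _ va.
rewrite /arr_norm hyps_over_underline//.
rewrite -(card_residue_ideal o_dvr pi0 piP (compact_dvr_residue_finite o_cdvr) F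
  (i0 := None) _ uu) ?in_setU1 ?eqxx//; last by rewrite /= aff_eval_coordX0.
congr (_%:R); apply: eq_card => y; rewrite !inE.
have formE (H : hyp A) : residue k (aff_eval phi (Defs.form (a := cone A) (Some H)) v) =
    form_value phi (red k) H a.
  rewrite /= aff_eval_homogenise A_homog rmorph0 mul0r add0r rmorph_sum.
  by apply: eq_bigr => j _; rewrite rmorphM; congr (_ * _); exact: va.
have H0E : residue k (aff_eval phi (Defs.form (a := cone A) None) v) = 0.
  rewrite /= aff_eval_coordX0 v0E; apply/eqP; rewrite (residue_eq0).
  by apply/(maxideal_powP piP); exists u.
have sumE (z : option (hyp A) -> R k) :
    \sum_(i in (None |: Some @: hyps_over x)%SET)
      residue k (aff_eval phi (Defs.form (a := cone A) i) v) * z i =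
    \sum_(H in hyps_over x) form_value phi (red k) H a * z (Some H).
  rewrite big_setU1/=; last by apply/imsetP => -[].
  rewrite H0E mul0r add0r big_imset/=; last by move=> ? ? _ _ [].
  by apply: eq_bigr => H _; rewrite formE.
apply/asboolP/asboolP => -[z ->]; last by exists (fun H => z (Some H)); rewrite sumE.
by exists (oapp z 0); rewrite sumE.
Qed.

(** The generating family is empty; this is why [m'] omits hat0. *)
Lemma card_flat_ideal_bot k (a : 'rV[R k]_d) : #|flat_ideal phi (red k) (\bot%O : flat A) a| = 1%N.
Proof.
rewrite -(cards1 (0 : R k)); apply: eq_card => y; rewrite !inE.
apply/asboolP/eqP => [[z ->]|->]; last exists (fun=> 0);
  by rewrite hyps_over_bot// big_set0.
Qed.

Lemma card_flat_ideal_gt0 k (a : 'rV[R k]_d) (x : flat A) :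
  (0 < #|flat_ideal phi (red k) x a|)%N.
Proof.
apply/card_gt0P; exists 0; rewrite inE; apply/asboolP.
by exists (fun=> 0); rewrite big1// => H _; rewrite mulr0.
Qed.

(** By [card_flat_ideal], the factor of [x] is the value of ||A_x, X_0||^(-mu_x) on the shell. The
    flat hat0 is left out since H_0 has an exponent of its own. *)
Definition shell_weight k (a : 'rV[R k]_d) : F :=
  \prod_(x : flat A | x != \bot%O) (#|flat_ideal phi (red k) x a|%:R / q%:R ^+ k) ^- mu x.

Lemma shell_weight_ge0 k (a : 'rV[R k]_d) : 0 <= shell_weight a.
Proof.
apply: prodr_ge0 => x _; rewrite invr_ge0 exprn_ge0// divr_ge0.
Qed.

(** An ideal has at least one element, so each normalised size is at least q^(-k). *)
Lemma shell_weight_le k (a : 'rV[R k]_d) : shell_weight a <= q%:R ^+ (k * m').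
Proof.
rewrite /m' big_distrr /= expr_sum; apply: ler_prod => x _.
rewrite invr_ge0 exprn_ge0/=; last by rewrite divr_ge0// exprn_ge0 ?ltW.
rewrite -exprVn invf_div exprM.
have qk0 : 0 <= (q%:R : F) ^+ k by rewrite exprn_ge0 ?ltW.
apply: lerXn2r; rewrite ?nnegrE ?divr_ge0//.
rewrite ler_pdivrMr ?ltr0n ?card_flat_ideal_gt0//.
by rewrite ler_peMr// ler1n card_flat_ideal_gt0.
Qed.

(** Dividing |I_x(a)| by q^k costs a factor q^(-k mu_x), which multiply to q^(-k m'). *)
Lemma ask_mu_matrix k :
  ask F (residue k : o -> residue_ring o k) (map_mx (map_mx phi) (mu_matrix mu)) =
  q%:R ^- (k * m') * \sum_(a : 'rV[R k]_d) shell_weight a.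
Proof.
rewrite (askE mu A_homog phi (red k) F) mulr_sumr; apply: eq_bigr => a _.
rewrite (bigD1 \bot%O)//= card_flat_ideal_bot expr1n invr1 mul1r.
rewrite /m' big_distrr /= expr_sum -prodfV -big_split/=; apply: eq_bigr => x _.
by rewrite expr_div_n invf_div exprM mulKf// expf_neq0// expf_neq0// gt_eqF.
Qed.

Section Exponent.
Variable s : F[i].
Let z : F[i] := s + m%:R - (mu \bot%O)%:R - d%:R - 1.
Let w k := cpow ((q%:R : F) ^- k) z.

(** This is [card_flat_ideal] at hat0, where the ideal has one element. *)
Lemma arr_norm_H0 k (a : 'rV[R k]_d) v : shell a v ->
  arr_norm F phi (cone_H0 A) v = q%:R ^- k.
Proof.
move=> /(card_flat_ideal (\bot%O : flat A)); rewrite card_flat_ideal_bot underline_bot// => e.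
by apply: (mulfI (expf_neq0 k (lt0r_neq0 q_gt0))); rewrite -e mulfV// expf_neq0// gt_eqF.
Qed.

Lemma zeta_integrand_shell k (a : 'rV[R k]_d) v : shell a v ->
  zeta_integrand phi (cone_exponent s m mu) v = w k * (shell_weight a)%:C.
Proof.
move=> av; rewrite /zeta_integrand prod_cone_flats//; last first.
  move=> y yH0; rewrite /cone_exponent; have [yE|_] := eqVneq y (cone_H0 A).
    by rewrite yE lexx in yH0.
  by rewrite lt_neqAle (negPf yH0) andbF /cpow eqxx.
rewrite {1}/cone_exponent eqxx (arr_norm_H0 av); congr (_ * _).
rewrite rmorph_prod; apply: eq_bigr => x xbot.
have xH0 : underline x != cone_H0 A.
  by rewrite -(underline_bot A_homog) (inj_eq (underline_inj A_homog)).
have H0x : (cone_H0 A < underline x)%O.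
  rewrite lt_neqAle eq_sym xH0; apply/asboolP => u xu.
  rewrite /cone_H0 /= => H /=; rewrite inE => /eqP ->.
  have : None \in hyps_over (underline x) by rewrite hyps_over_underline// in_setU1.
  by rewrite inE => /asboolP; exact.
rewrite /cone_exponent (negPf xH0) H0x.
(* Injectivity of [underline] ensures that the flat picked in [cone_exponent] is [x]. *)
case: pickP => [x' /eqP/(underline_inj A_homog) ->|/(_ x)]; last by rewrite eqxx.
have xE := card_flat_ideal x av.
have -> : arr_norm F phi (underline x) v = #|flat_ideal phi (red k) x a|%:R / q%:R ^+ k.
  by rewrite xE mulrC mulKf// expf_neq0// gt_eqF.
by rewrite cpow_natN// divr_gt0 ?ltr0n ?card_flat_ideal_gt0// exprn_gt0.
Qed.

Let z_Re : complex.Re z = complex.Re s + m'%:R - d%:R - 1.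
Proof.
have -> : z = s + (m'%:R - d%:R - 1)%:C.
  rewrite /z /m (bigD1 \bot%O)//= natrD !rmorphB rmorph1 !rmorph_nat -/m'; ring.
by case: s => x y /=; ring.
Qed.

Hypothesis s_large : (d.+1)%:R < complex.Re s.

(** Off the shells v_0 = 0, and the factor of H_0 is 0 to the power [z]. As 0 to the power 0 is 1 by
    convention, [z] must be nonzero; indeed its real part is positive. *)
Lemma zeta_integrand_off v : (forall k (a : 'rV[R k]_d), ~ shell a v) ->
  zeta_integrand phi (cone_exponent s m mu) v = 0.
Proof.
move=> noshell; have v0 : (v : 'rV[o]_d.+1) 0 0 = 0.
  apply/eqP/negPn/negP => /(shell_cover o_cdvr pi0 piP)[k [a]]; exact: noshell.
rewrite /zeta_integrand (bigD1 (cone_H0 A)) ?cone_H0_neq_bot//=.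
rewrite {1}/cone_exponent eqxx -/z.
have -> : arr_norm F phi (cone_H0 A) v = 0.
  rewrite /arr_norm -underline_bot// hyps_over_underline// hyps_over_bot// imset0 finset.setU0.
  rewrite big_set1E /= aff_eval_coordX0 v0 /absv eqxx; exact: maxxx.
rewrite /cpow eqxx ifF ?mul0r//; apply/negP => /eqP z0.
have := z_Re; rewrite z0 /= => e; move: s_large; rewrite -natr1.
have : (0 <= m'%:R :> F) by []; lra.
Qed.

Let lnqV k : ln ((q%:R : F) ^- k) = - (k%:R * ln q%:R).
Proof. by rewrite lnV ?posrE ?exprn_gt0// lnXn// mulr_natl. Qed.

Let qVE n : (q%:R : F) ^- n = expR (- (n%:R * ln q%:R)).
Proof. by rewrite -lnqV lnK// posrE invr_gt0 exprn_gt0. Qed.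

Let wE k : w k = cexp (z * (- (k%:R * ln q%:R))%:C).
Proof. by rewrite /w cpowE ?lnqV// invr_gt0 exprn_gt0. Qed.

(** The origin of the bound d + 1 on Re(s): it gives Re(z) >= m', so that |w k| = q^(-k Re(z))
    offsets the bound q^(k m') on the weight. *)
Lemma expR_w_le1 k (a : 'rV[R k]_d) :
  expR (complex.Re (z * (- (k%:R * ln q%:R))%:C)) * shell_weight a <= 1.
Proof.
apply: le_trans (ler_wpM2l (expR_ge0 _) (shell_weight_le a)) _.
rewrite -[q%:R ^+ _]invrK qVE -expRN -expRD -[leRHS]expR0 ler_expR.
have -> : complex.Re (z * (- (k%:R * ln q%:R))%:C) = - complex.Re z * (k%:R * ln q%:R).
  by case: (z) => x y /=; ring.
have L0 : 0 <= k%:R * ln q%:R :> F by rewrite mulr_ge0// ln_ge0// ltW.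
rewrite z_Re natrM; move: s_large; rewrite -natr1 => s1; nra.
Qed.

Let Re_scale (x : F[i]) (r : F) : complex.Re (x * r%:C) = complex.Re x * r.
Proof. by case: x => x y /=; ring. Qed.
Let Im_scale (x : F[i]) (r : F) : complex.Im (x * r%:C) = complex.Im x * r.
Proof. by case: x => x y /=; ring. Qed.

Lemma Re_shell_le1 k (a : 'rV[R k]_d) : `|complex.Re (w k * (shell_weight a)%:C)| <= 1.
Proof.
rewrite Re_scale normrM (ger0_norm (shell_weight_ge0 a)) wE.
by apply: le_trans (expR_w_le1 a); rewrite ler_wpM2r ?shell_weight_ge0 ?norm_Re_cexp_le.
Qed.

Lemma Im_shell_le1 k (a : 'rV[R k]_d) : `|complex.Im (w k * (shell_weight a)%:C)| <= 1.
Proof.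
rewrite Im_scale normrM (ger0_norm (shell_weight_ge0 a)) wE.
by apply: le_trans (expR_w_le1 a); rewrite ler_wpM2r ?shell_weight_ge0 ?norm_Im_cexp_le.
Qed.

Let A_mu := map_mx (map_mx phi) (mu_matrix mu).

Lemma ask_zeta_termE k :
  (1 - q%:R^-1) * ask_zeta_term A_mu s k =
  w k * (q%:R ^- (k * d.+1) * (1 - q%:R^-1) * \sum_(a : 'rV[R k]_d) shell_weight a)%:C.
Proof.
(* Comparing exponents of q^(-k): m' + s = z + (d + 1). This identity determines the exponent at
   H_0. *)
have key : (q%:R ^- (k * m') : F)%:C * cpow (q%:R : F) (- (k%:R * s)) =
    w k * (q%:R ^- (k * d.+1) : F)%:C.
  rewrite !qVE -!cexp_real wE cpowE// -!cexpD; congr cexp.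
  rewrite /z /m (bigD1 \bot%O)//= -/m' !natrM -natr1 natrD.
  rewrite !(rmorphN, rmorphM, rmorphD, rmorph_nat, rmorph1); ring.
have -> : 1 - q%:R^-1 = (1 - q%:R^-1 : F)%:C :> F[i].
  by rewrite rmorphB rmorph1 fmorphV rmorph_nat.
rewrite /ask_zeta_term ask_mu_matrix -/q.
set Q := q%:R ^- (k * m'); set Q' := q%:R ^- (k * d.+1).
set e := 1 - q%:R^-1; set S := \sum_a _.
rewrite -/Q -/Q' in key; rewrite !rmorphM /=.
transitivity (Q%:C * cpow (q%:R : F) (- (k%:R * s)) * (e%:C * S%:C)).
  move: (Q%:C) (e%:C) (S%:C) (cpow _ _) => x1 x2 x3 x4; ring.
by rewrite key -!mulrA.
Qed.

Variables (P : probability (borel o d.+1) F) (P_haar : is_haar P).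

Let fine_shell k (a : 'rV[R k]_d) : fine (P (shell a)) = q%:R ^- (k * d.+1) * (1 - q%:R^-1).
Proof. by rewrite (haar_shell pi0 piP P_haar). Qed.

Lemma cone_zeta_integrable : zeta_integrable phi P (cone_exponent s m mu).
Proof.
split.
  apply: (@step_function_integrable _ _ F P (fun k => 'rV[R k]_d)
    (fun k a => shell a) (fun k a => complex.Re (w k * (shell_weight a)%:C))).
  - by move=> k a; exact: shell_measurable.
  - by move=> k a v /zeta_integrand_shell ->.
  - by move=> v /zeta_integrand_off ->.
  - exact: Re_shell_le1.
apply: (@step_function_integrable _ _ F P (fun k => 'rV[R k]_d)
  (fun k a => shell a) (fun k a => complex.Im (w k * (shell_weight a)%:C))).
- by move=> k a; exact: shell_measurable.
- by move=> k a v /zeta_integrand_shell ->.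
- by move=> v /zeta_integrand_off ->.
- exact: Im_shell_le1.
Qed.

Lemma ask_zeta_series_cvg :
  (fun n => (1 - q%:R^-1) * ask_zeta_series A_mu s n : F[i]^o) @ \oo -->
  (arr_zeta phi P (cone_exponent s m mu) : F[i]^o).
Proof.
have ReD : {morph @complex.Re F : x y / x + y} by move=> [? ?] [? ?].
have ImD : {morph @complex.Im F : x y / x + y} by move=> [? ?] [? ?].
(* Real and imaginary parts are handled separately, each as a real step function on the same
   shells. *)
apply: cvg_complex => /=.
  rewrite (_ : (fun n => _) = series (fun k => \sum_(a : 'rV[R k]_d)
      complex.Re (w k * (shell_weight a)%:C) * fine (P (shell a)))).
    apply: (@step_function_integral _ _ F P (fun k => 'rV[R k]_d)
      (fun k a => shell a) (fun k a => complex.Re (w k * (shell_weight a)%:C))).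
    - by move=> k a; exact: shell_measurable.
    - by move=> k l a b v; exact: shell_disjoint.
    - by move=> k a b v; exact: shell_disjoint_level.
    - by move=> k a v /zeta_integrand_shell ->.
    - by move=> v /zeta_integrand_off ->.
    - exact: Re_shell_le1.
  apply/funext => n; rewrite /ask_zeta_series /series /= mulr_sumr.
  rewrite (big_morph _ ReD (erefl : complex.Re (0 : F[i]) = 0)).
  apply: eq_bigr => k _; rewrite ask_zeta_termE Re_scale mulrCA mulr_sumr mulr_sumr.
  by apply: eq_bigr => a _; rewrite Re_scale fine_shell; ring.
rewrite (_ : (fun n => _) = series (fun k => \sum_(a : 'rV[R k]_d)
    complex.Im (w k * (shell_weight a)%:C) * fine (P (shell a)))).
  apply: (@step_function_integral _ _ F P (fun k => 'rV[R k]_d)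
    (fun k a => shell a) (fun k a => complex.Im (w k * (shell_weight a)%:C))).
  - by move=> k a; exact: shell_measurable.
  - by move=> k l a b v; exact: shell_disjoint.
  - by move=> k a b v; exact: shell_disjoint_level.
  - by move=> k a v /zeta_integrand_shell ->.
  - by move=> v /zeta_integrand_off ->.
  - exact: Im_shell_le1.
apply/funext => n; rewrite /ask_zeta_series /series /= mulr_sumr.
rewrite (big_morph _ ImD (erefl : complex.Im (0 : F[i]) = 0)).
apply: eq_bigr => k _; rewrite ask_zeta_termE Im_scale mulrCA mulr_sumr mulr_sumr.
by apply: eq_bigr => a _; rewrite Im_scale fine_shell; ring.
Qed.

End Exponent.
End ConeIntegral.

Theorem theorem1p2 (F : realType) (K : fieldExtType rat) (d : nat)
  (A : arrangement K d) (A_central : central A) (A_homog : homogeneous A)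
  (mu : flat A -> nat)
  (o : topIdomainType) (o_cdvr : is_compact_dvr o)
  (phi : {rmorphism OK K -> o})
  (P : probability (borel o d.+1) F) (P_haar : is_haar P) :
  let m := (\sum_(x : flat A) mu x)%N in
  let q := residue_card o in
  let A_mu := map_mx (map_mx phi) (mu_matrix mu) in
  exists s0 : F, forall s : F[i], s0 < complex.Re s ->
    [/\ cvgn (ask_zeta_series A_mu s),
        zeta_integrable phi P (cone_exponent s m mu)
      & ask_zeta A_mu s =
        (1 - q%:R^-1)^-1 * arr_zeta phi P (cone_exponent s m mu)].
Proof.
move=> m q A_mu; have [pi pi0 piP] := dvr_uniformizer (cdvr_dvr o_cdvr).
exists d.+1%:R => s s_large.
have e0 : 1 - q%:R^-1 != 0 :> F[i].
  rewrite subr_eq0 eq_sym invr_eq1 pnatr_eq1 gtn_eqF//.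
  exact: (residue_card_gt1 pi0 piP (compact_dvr_residue_finite o_cdvr)).
have cvg_ask : ask_zeta_series A_mu s @ \oo -->
    ((1 - q%:R^-1)^-1 * arr_zeta phi P (cone_exponent s m mu) : F[i]^o).
  rewrite (_ : ask_zeta_series A_mu s = fun n =>
      (1 - q%:R^-1)^-1 * ((1 - q%:R^-1) * ask_zeta_series A_mu s n)).
    apply: (@cvgM F[i]); first exact: cvg_cst.
    exact: (ask_zeta_series_cvg A_homog o_cdvr pi0 piP s_large P_haar).
  by apply/funext => n; rewrite mulKf.
split; first by apply/cvg_ex; eexists; exact: cvg_ask.
  exact: (@cone_zeta_integrable _ _ _ _ A_homog mu _ o_cdvr phi _ pi0 piP _ s_large P).
exact: cvg_lim cvg_ask.
Qed.
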